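(* Let $\alpha>0$ and let $\rho$ be a nonzero $\sigma$-finite measure on $(0,\infty)$ satisfying $$\int_0^\infty \bigl(y^{\alpha-\delta}\vee y^{\alpha+\delta}\bigr)\,\rho(dy)<\infty\qquad\text{for some }\delta>0 .$$ Assume that $$\int_0^\infty y^{\alpha+i\theta}\,\rho(dy)\neq 0\qquad\text{for all }\theta\in\mathbb{R}. \qquad ( * )$$ Suppose that, for some $\sigma$-finite measure $\nu$ on $(0,\infty)$, the measure $\nu\circledast\rho$ has a regularly varying tail with exponent $\alpha$ and $$\lim_{b\to 0}\limsup_{x\to\infty}\frac{\int_0^b\rho(x/y,\infty)\,\nu(dy)}{(\nu\circledast\rho)(x,\infty)}=0. \qquad ( ** )$$ Then the measure $\nu$ has a regularly varying tail with exponent $\alpha$ as well, and $$\lim_{x\to\infty}\frac{(\nu\circledast\rho)(x,\infty)}{\nu(x,\infty)}=\int_0^\infty y^\alpha\,\rho(dy).$$ Conversely, if $( * )$ does not hold, then there exists a $\sigma$-finite measure $\nu$ on $(0,\infty)$ without a regularly varying tail, such that the measure $\nu\circledast\rho$ has a regularly varying tail with exponent $\alpha$ and $( ** )$ holds.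
   Context: For $\sigma$-finite measures $\nu,\rho$ on $(0,\infty)$, the multiplicative convolution $\nu\circledast\rho$ is the measure on $(0,\infty)$ defined by $(\nu\circledast\rho)(B)=\int_0^\infty \nu(x^{-1}B)\,\rho(dx)$ for Borel subsets $B$ of $(0,\infty)$. A measure $\mu$ on $\mathbb{R}$ (or on $(0,\infty)$) with $\mu(a,\infty)<\infty$ for some $a>0$ large enough has a regularly varying (right) tail with exponent $\alpha\ge 0$ if $\mu(x,\infty)=x^{-\alpha}L(x)$ (for large $x$), where $L$ is slowly varying at infinity, i.e. $L$ is eventually positive and $L(cx)/L(x)\to1$ as $x\to\infty$ for every $c>0$. ''Regularly varying tail'' without mention of an exponent means with some exponent. Notation: $u\vee v=\max(u,v)$, and $\mu(a,b]=\mu((a,b])$, $\mu(a,\infty)=\mu((a,\infty))$. *)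

(* Defs.v *)
From HB Require Import structures.
From mathcomp Require Import all_boot all_order all_algebra.
From mathcomp Require Import complex.
From mathcomp Require Import all_classical all_reals all_analysis.

Set Implicit Arguments.
Unset Strict Implicit.
Unset Printing Implicit Defensive.

Import Order.TTheory GRing.Theory Num.Theory.
Import numFieldNormedType.Exports.

Local Open Scope classical_set_scope.
Local Open Scope ring_scope.

(* A measure on (0, oo) is a Borel measure on R giving no mass to (-oo, 0]. *)
Definition on_positives (R : realType)
    (mu : {measure set (measurableTypeR R) -> \bar R}) : Prop :=
  mu `]-oo, 0%R]%classic = 0%E.

Definition scale_set (R : realType) (c : R) (B : set R) : set R :=
  (fun b => c * b) @` B.

Definition mconv (R : realType)
    (nu rho : {measure set (measurableTypeR R) -> \bar R})
    (B : set (measurableTypeR R)) : \bar R :=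
  (\int[rho]_(x in `]0%R, +oo[%classic) nu (scale_set (x^-1)%R B))%E.

Definition slowly_varying (R : realType) (L : R -> R) : Prop :=
  (\forall x \near +oo, 0 < L x) /\
  (forall c : R, 0 < c -> L (c * x) / L x @[x --> +oo] --> (1 : R)).

(* Stated for set functions, so that it applies to mconv nu rho directly. *)
Definition rv_tail_exp (R : realType) (alpha : R)
    (mu : set (measurableTypeR R) -> \bar R) : Prop :=
  [/\ 0 <= alpha,
      exists2 a : R, 0 < a & (mu `]a, +oo[%classic < +oo)%E &
      exists2 L : R -> R, slowly_varying L &
        \forall x \near +oo, mu `]x, +oo[%classic = (x `^ (- alpha) * L x)%:E].

Definition rv_tail (R : realType)
    (mu : set (measurableTypeR R) -> \bar R) : Prop :=
  exists alpha : R, rv_tail_exp alpha mu.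

(* y^z = exp (z ln y), for y > 0. *)
Definition cpow (R : realType) (y : R) (z : R[i]) : R[i] :=
  Complex (y `^ complex.Re z * cos (complex.Im z * ln y))
          (y `^ complex.Re z * sin (complex.Im z * ln y)).

(* Meaningful when the real and imaginary parts of f are mu-integrable on D. *)
Definition cintegral (R : realType)
    (mu : {measure set (measurableTypeR R) -> \bar R})
    (D : set (measurableTypeR R)) (f : R -> R[i]) : R[i] :=
  Complex (\int[mu]_(y in D) complex.Re (f y)) (\int[mu]_(y in D) complex.Im (f y)).

Definition small_factor_negligible (R : realType)
    (nu rho : {measure set (measurableTypeR R) -> \bar R}) : Prop :=
  limf_esup (fun x : R =>
      ((\int[nu]_(y in `]0%R, b]%classic) rho `](x / (y : R))%R, +oo[%classic)
         / mconv nu rho `]x, +oo[%classic)%E) (pinfty_nbhs R)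
    @[b --> (0 : R)^'+] --> 0%E.

(* Main.v *)
Require Import Defs.
From HB Require Import structures.
From mathcomp Require Import all_boot all_order all_algebra.
From mathcomp Require Import complex.
From mathcomp Require Import all_classical all_reals all_analysis.
From mathcomp Require Import measurable_realfun.
From mathcomp Require Import ring lra.

Set Implicit Arguments.
Unset Strict Implicit.
Unset Printing Implicit Defensive.

Import Order.TTheory GRing.Theory Num.Theory.
Import numFieldNormedType.Exports.

Local Open Scope classical_set_scope.
Local Open Scope ring_scope.

(** In logarithmic coordinates the convolution becomes additive.  Write
    [N x] and [M x] for the tails of [nu] and of the convolution at [expR x],
    and let [w] be the image under [ln] of the measure with density [y `^ alpha]
    with respect to [rho].  Then [expR (alpha * x) * M x] is the convolution of
    [expR (alpha * x) * N x] with [w].  The moment condition says that [w] has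
    exponential moments of order [delta], and the nonvanishing hypothesis says
    that the Fourier transform of [w] has no real zero.

    Direct part.  If a bounded function [k] has [k] convolved with [w] equal to
    one, one expects [k] to be the constant [1 / w(R)], because the Fourier
    transform of [w] can be divided out.  Here this is made quantitative, for
    a sequence of functions [k] whose convolutions with [w] tend to one
    ([kernel_sequence_cvg]).  Since [w] has two moments, its transform is
    twice continuously differentiable, hence so is its inverse; multiplied by a
    triangular cut-off at frequency [A] it is the transform of a function
    [deconv] that is [O(1 / (1 + t ^ 2))], and the convolution of [deconv] with
    [w] is the Fejer kernel ([weighted_int_deconv]).  This follows by exchanging
    the two integrations.  Pairing [k] with a Fejer kernel is
    therefore pairing its convolution with [w], which tends to one, with the
    integrable function [deconv].  So the Fejer averages of [k] around every
    point tend to [1 / w(R)].  The functions at hand are tails multiplied by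
    exponentials, so they cannot increase fast, and averages over shrinking
    windows determine the value itself ([k_squeeze]).

    The sequence to which this applies is
    [k u = expR (alpha * u) * N (x + u) / M x] as [x] tends to infinity.  Regular
    variation of [M] says that its convolution with [w] tends to one.  Potter's
    bounds ([potter]) give [k u <= C * expR (delta * `|u|)] uniformly, which [w]
    integrates, while for each fixed [u] the values are eventually below a
    constant that does not depend on [u]; truncating [k] at that constant
    changes its convolution by a vanishing amount, by dominated convergence, and
    leaves bounded functions ([tauberian_tail_ratio]).

    All this requires [N] to be bounded, so [nu] is cut off near zero.  The
    negligibility condition is designed for this, but it lets the cut-off tend to
    zero, whereas the argument needs a fixed one at which the tail of [nu] is
    finite.  In fact the contribution of the mass of [nu] below any fixed level
    is asymptotically negligible ([small_part_negl]).

    Converse.  If the transform vanishes at [theta], take for [nu] the power tail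
    perturbed by a small oscillation of angular frequency [theta] in the
    logarithm of the variable.  Convolution with [rho] kills the oscillation, so
    the convolution has an exact power tail ([mconv_osc]), while the tail of [nu]
    is a power times a nonconstant periodic function ([osc_not_rv]). *)

(** * Integration of real-valued functions *)
Section RealIntegration.
Context d (T : measurableType d) (R : realType).
Variable mu : {measure set T -> \bar R}.
Implicit Types (f g : T -> R).

Lemma integrable_measurable f :
  mu.-integrable setT (EFin \o f) -> measurable_fun setT f.
Proof. by move=> /integrableP[/measurable_EFinP]. Qed.

Lemma integrable_dominated f g :
  measurable_fun setT f -> mu.-integrable setT (EFin \o g) ->
  (forall y, `|f y| <= g y) -> mu.-integrable setT (EFin \o f).
Proof.
move=> mf ig fg; apply: le_integrable ig => //.
  exact/measurable_EFinP.
by move=> y _ /=; rewrite lee_fin (le_trans (fg y))// ler_norm.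
Qed.

Lemma norm_Rintegral_le f g :
  measurable_fun setT f -> mu.-integrable setT (EFin \o g) ->
  (forall y, `|f y| <= g y) ->
  `|\int[mu]_y f y| <= \int[mu]_y g y.
Proof.
move=> mf ig fg; have jf := integrable_dominated mf ig fg.
apply: (le_trans (le_normr_Rintegral measurableT jf)).
apply: le_Rintegral => //.
apply: (integrable_dominated _ ig); first exact: measurableT_comp.
by move=> y; rewrite normr_id.
Qed.

Lemma Rintegral_dominated_cvg (F : nat -> T -> R) f g :
  (forall n, measurable_fun setT (F n)) ->
  (forall y, F n y @[n --> \oo] --> f y) ->
  mu.-integrable setT (EFin \o g) ->
  (forall n y, `|F n y| <= g y) ->
  \int[mu]_y F n y @[n --> \oo] --> \int[mu]_y f y.
Proof.
move=> mF Ff ig Fg.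
have mf : measurable_fun setT f.
  by apply: (measurable_fun_cvg mF) => y _; exact: Ff.
have Ff' y : setT y -> (F n y)%:E @[n --> \oo] --> (EFin \o f) y.
  by move=> _; apply/fine_cvgP; split; [exact: nearW|exact: Ff].
have [|||intf _ cv] := @dominated_convergence _ _ _ mu setT measurableT
  (fun n y => (F n y)%:E) (EFin \o f) (EFin \o g) _ _ (aeW _ Ff') ig.
- by move=> n; apply/measurable_EFinP; exact: mF.
- exact/measurable_EFinP.
- by apply: aeW => y n _; rewrite lee_fin.
apply: (@fine_cvg _ _ _ _ (fun n => \int[mu]_y (F n y)%:E)%E).
by rewrite fineK//; exact: integrable_fin_num intf.
Qed.

End RealIntegration.

(** Integrability of every slice, and not just of almost every one, is assumed
    so that the inner real-valued integrals are genuine integrals. *)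
Section RealFubini.
Context d1 d2 (T1 : measurableType d1) (T2 : measurableType d2) (R : realType).
Variables (m1 : {sigma_finite_measure set T1 -> \bar R})
          (m2 : {sigma_finite_measure set T2 -> \bar R}).
Variable F : T1 -> T2 -> R.
Hypothesis mF : measurable_fun setT (fun z : T1 * T2 => F z.1 z.2).
Hypothesis slice1 : forall x, m2.-integrable setT (EFin \o F x).
Hypothesis slice2 : forall y, m1.-integrable setT (EFin \o F ^~ y).
Variable b : T2 -> R.
Hypothesis ib : m2.-integrable setT (EFin \o b).
Hypothesis Fb : forall y, \int[m1]_x `|F x y| <= b y.

Lemma prod_integrable : (m1 \x m2)%E.-integrable setT (fun z => (F z.1 z.2)%:E).
Proof.
apply/integrable21ltyP; first exact/measurable_EFinP.
case/integrableP : (ib) => mb; apply: le_lt_trans.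
apply: ge0_le_integral => //.
- by move=> y _; exact: integral_ge0.
- apply: (measurable_fun_fubini_tonelli_G (fun z => `|(F z.1 z.2)%:E|%E)).
  + by apply: measurableT_comp => //; exact/measurable_EFinP.
  + by [].
- exact: measurableT_comp.
- move=> y _ /=; apply: (@le_trans _ _ (b y)%:E).
    have i2 : m1.-integrable setT (EFin \o (fun x => `|F x y|)).
      by have := integrable_abse (slice2 y); exact: eq_integrable.
    rewrite -(fineK (integrable_fin_num measurableT i2)) lee_fin.
    exact: Fb.
  by rewrite lee_fin ler_norm.
Qed.

Lemma Rintegral_exchange :
  \int[m1]_x \int[m2]_y F x y = \int[m2]_y \int[m1]_x F x y.
Proof.
have := Fubini prod_integrable.
rewrite /Rintegral /=.
under eq_integral => x _ do
  rewrite -(fineK (integrable_fin_num measurableT (slice1 x))).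
under [in X in _ = X -> _]eq_integral => y _ do
  rewrite -(fineK (integrable_fin_num measurableT (slice2 y))).
by move=> ->.
Qed.

Lemma measurable_slice_integral :
  measurable_fun setT (fun x => \int[m2]_y F x y).
Proof.
apply: measurableT_comp => //.
exact: (measurable_fubini_F prod_integrable).
Qed.

End RealFubini.

Section DominatedFubini.
Context d1 d2 (T1 : measurableType d1) (T2 : measurableType d2) (R : realType).
Variables (m1 : {sigma_finite_measure set T1 -> \bar R})
          (m2 : {sigma_finite_measure set T2 -> \bar R}).
Variables (F : T1 -> T2 -> R) (a : T1 -> R) (b : T2 -> R).
Hypothesis mF : measurable_fun setT (fun z : T1 * T2 => F z.1 z.2).
Hypothesis ia : m1.-integrable setT (EFin \o a).
Hypothesis ib : m2.-integrable setT (EFin \o b).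
Hypothesis Fab : forall x y, `|F x y| <= a x * b y.

Lemma dominated_slice1 x : m2.-integrable setT (EFin \o F x).
Proof.
apply: (@integrable_dominated _ _ _ _ _ (fun y => a x * b y)) => //.
  exact: (measurableT_comp mF (pair1_measurable x)).
have := @integrableZl _ _ _ m2 setT measurableT (a x) _ ib.
by apply: eq_integrable => // y _.
Qed.

Let ia_mul y : m1.-integrable setT (EFin \o (fun x => b y * a x)).
Proof.
have := @integrableZl _ _ _ m1 setT measurableT (b y) _ ia.
by apply: eq_integrable => // x _.
Qed.

Lemma dominated_slice2 y : m1.-integrable setT (EFin \o F ^~ y).
Proof.
apply: (@integrable_dominated _ _ _ _ _ (fun x => b y * a x)) => //.
- exact: (measurableT_comp mF (pair2_measurable y)).
- by move=> x; rewrite mulrC.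
Qed.

Let ib_mul : m2.-integrable setT (EFin \o (fun y => (\int[m1]_x a x) * b y)).
Proof.
have := @integrableZl _ _ _ m2 setT measurableT (\int[m1]_x a x) _ ib.
by apply: eq_integrable => // x _.
Qed.

Let slice_norm y : \int[m1]_x `|F x y| <= (\int[m1]_x a x) * b y.
Proof.
rewrite mulrC -RintegralZl//; apply: le_Rintegral => //.
  by have := integrable_abse (dominated_slice2 y); exact: eq_integrable.
by move=> x _; rewrite mulrC.
Qed.

Lemma dominated_exchange :
  \int[m1]_x \int[m2]_y F x y = \int[m2]_y \int[m1]_x F x y.
Proof.
exact: (Rintegral_exchange mF dominated_slice1 dominated_slice2 ib_mul slice_norm).
Qed.

Lemma measurable_dominated_slice :
  measurable_fun setT (fun x => \int[m2]_y F x y).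
Proof.
exact: (measurable_slice_integral mF dominated_slice2 ib_mul slice_norm).
Qed.

End DominatedFubini.

Section Translation.
Variable R : realType.
Local Notation leb := (@lebesgue_measure R).

Definition translate (a : R) (x : measurableTypeR R) : measurableTypeR R := x + a.

Lemma measurable_translate (a : R) : measurable_fun setT (translate a).
Proof. exact: measurable_funD. Qed.

Let shifted (a : R) : {measure set (measurableTypeR R) -> \bar R} :=
  measure_function_pushforward__canonical__measure_function_Measure
    leb (measurable_translate a).

Lemma lebesgue_translation (a : R) (A : set (measurableTypeR R)) :
  measurable A -> leb A = pushforward leb (translate a) A.
Proof.
move=> mA; apply: (@lebesgue_measure_unique _ (shifted a)) => // X [[u v]] _ <-.
rewrite /shifted/= /pushforward.
have -> : translate a @^-1` `]u, v] = `]u - a, v - a]%classic.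
  by apply/seteqP; split => x /=; rewrite !in_itv/= ltrBlDr lerBrDr.
rewrite !lebesgue_measure_itv/= !lte_fin ltrD2r.
by case: ifP => // _; rewrite -!EFinB opprB addrA subrK.
Qed.

Lemma integrable_translation (f : R -> R) (a : R) :
  leb.-integrable setT (EFin \o f) ->
  leb.-integrable setT (EFin \o (fun x => f (x + a))).
Proof.
move=> jf; have mf := integrable_measurable jf.
apply/integrableP; split.
  apply/measurable_EFinP; exact: (measurableT_comp mf (measurable_translate a)).
case/integrableP : jf => _; apply: le_lt_trans.
rewrite [leRHS](@eq_measure_integral _ _ _ _ (shifted a) leb);
  last by move=> A mA _; exact: lebesgue_translation.
rewrite ge0_integral_pushforward//; first exact: measurable_translate.
by apply: measurableT_comp => //; exact/measurable_EFinP.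
Qed.

Lemma Rintegral_translation (f : R -> R) (a : R) :
  leb.-integrable setT (EFin \o f) ->
  \int[leb]_x f (x + a) = \int[leb]_x f x.
Proof.
move=> jf; have mf := integrable_measurable jf.
rewrite /Rintegral; congr fine.
rewrite [RHS](@eq_measure_integral _ _ _ _ (shifted a) leb);
  last by move=> A mA _; exact: lebesgue_translation.
rewrite integral_pushforward//; first exact: measurable_translate.
- exact/measurable_EFinP.
- exact: integrable_translation.
Qed.
End Translation.

(** * Functions of class C1 and C2 *)
Section Smooth.
Variable R : realType.
Implicit Types f g : R -> R.

Definition C1 f := exists f1, (forall x : R, is_derive x 1 f (f1 x)) /\ continuous f1.
Definition C2 f := exists f1, (forall x : R, is_derive x 1 f (f1 x)) /\ C1 f1.

Lemma is_derive_add f g (x a b : R) : is_derive x 1 f a -> is_derive x 1 g b ->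
  is_derive x 1 (fun y => f y + g y) (a + b).
Proof. exact: is_deriveD. Qed.

Lemma is_derive_mul f g (x a b : R) : is_derive x 1 f a -> is_derive x 1 g b ->
  is_derive x 1 (fun y => f y * g y) (f x * b + g x * a).
Proof. by move=> df dg; exact: is_deriveM. Qed.

Lemma is_derive_inv f (x a : R) : f x != 0 -> is_derive x 1 f a ->
  is_derive x 1 (fun y => (f y)^-1) (- f x ^- 2 * a).
Proof. exact: is_deriveV. Qed.

Lemma is_derive_value f (x a b : R) : a = b -> is_derive x 1 f a -> is_derive x 1 f b.
Proof. by move=> ->. Qed.

Lemma is_derive_affine (a b x : R) : is_derive x 1 (fun y => a + b * y) b.
Proof.
have := is_derive_add (@is_derive_cst _ _ _ a x 1)
  (is_derive_mul (@is_derive_cst _ _ _ b x 1) (@is_derive_id _ _ x 1)).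
by apply: is_derive_value; rewrite /cst mulr1 mulr0 addr0 add0r.
Qed.

Lemma is_derive_cos_comp f (x a : R) : is_derive x 1 f a ->
  is_derive x 1 (fun y => cos (f y)) (- sin (f x) * a).
Proof. by move=> df; exact: (is_derive1_comp (is_derive_cos (f x)) df). Qed.

Lemma is_derive_sin_comp f (x a : R) : is_derive x 1 f a ->
  is_derive x 1 (fun y => sin (f y)) (cos (f x) * a).
Proof. by move=> df; exact: (is_derive1_comp (is_derive_sin (f x)) df). Qed.

Lemma C1_continuous f : C1 f -> continuous f.
Proof.
move=> [f1 [df _]] x; apply: differentiable_continuous.
by apply/derivable1_diffP; case: (df x).
Qed.

Lemma C2_C1 f : C2 f -> C1 f.
Proof. by move=> [f1 [df /C1_continuous cf]]; exists f1. Qed.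

Lemma C1D f g : C1 f -> C1 g -> C1 (fun x => f x + g x).
Proof.
move=> [f1 [df cf]] [g1 [dg cg]]; exists (fun x => f1 x + g1 x); split.
  by move=> x; exact: is_derive_add.
by move=> x; apply: cvgD; [exact: cf|exact: cg].
Qed.

Lemma C1M f g : C1 f -> C1 g -> C1 (fun x => f x * g x).
Proof.
move=> Cf Cg; have [f1 [df cf]] := Cf; have [g1 [dg cg]] := Cg.
exists (fun x => f x * g1 x + g x * f1 x); split.
  by move=> x; exact: is_derive_mul.
move=> x; apply: cvgD; apply: cvgM;
  by [exact: C1_continuous|exact: cf|exact: cg].
Qed.

Lemma C1V f : (forall x, f x != 0) -> C1 f -> C1 (fun x => (f x)^-1).
Proof.
move=> f0 Cf; have [f1 [df cf]] := Cf.
exists (fun x => - f x ^- 2 * f1 x); split.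
  by move=> x; exact: is_derive_inv.
move=> x; apply: cvgM; last exact: cf.
apply: cvgN; apply: cvgV; first by rewrite expf_neq0.
by apply: cvgM; exact: C1_continuous.
Qed.

Lemma C1_affine (a b : R) : C1 (fun x => a + b * x).
Proof.
exists (fun=> b); split; last by move=> x; exact: cvg_cst.
by move=> x; exact: is_derive_affine.
Qed.

Lemma C2_affine (a b : R) : C2 (fun x => a + b * x).
Proof.
exists (fun=> b); split; last first.
  by have := C1_affine b 0; congr C1; apply/funext => x; rewrite mul0r addr0.
by move=> x; exact: is_derive_affine.
Qed.

Lemma C2D f g : C2 f -> C2 g -> C2 (fun x => f x + g x).
Proof.
move=> [f1 [df cf]] [g1 [dg cg]]; exists (fun x => f1 x + g1 x); split.
  by move=> x; exact: is_derive_add.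
exact: C1D.
Qed.

Lemma C2M f g : C2 f -> C2 g -> C2 (fun x => f x * g x).
Proof.
move=> Cf Cg; have [f1 [df cf]] := Cf; have [g1 [dg cg]] := Cg.
exists (fun x => f x * g1 x + g x * f1 x); split.
  by move=> x; exact: is_derive_mul.
by apply: C1D; apply: C1M => //; exact: C2_C1.
Qed.

Lemma C2V f : (forall x, f x != 0) -> C2 f -> C2 (fun x => (f x)^-1).
Proof.
move=> f0 Cf; have [f1 [df cf]] := Cf.
exists (fun x => - f x ^- 2 * f1 x); split.
  by move=> x; exact: is_derive_inv.
apply: C1M => //.
have H : C1 (fun x => (-1 + 0 * x) * (f x * f x)^-1).
  apply: C1M; first exact: C1_affine.
  apply: C1V; first by move=> x; rewrite mulf_neq0.
  by apply: C1M; exact: C2_C1.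
by move: H; congr C1; apply/funext => x; rewrite mul0r addr0 mulN1r expr2.
Qed.

End Smooth.

(** * The Fourier transform of a weighted measure *)
Section Weighted.
Context d (T : measurableType d) (R : realType).
Variable mu : {sigma_finite_measure set T -> \bar R}.
Variables (om l : T -> R).

(** The integral of [f] against the image under [l] of the measure with density
    [om]; the pair [(om, l)] stands for that measure on the line. *)
Definition weighted_int (f : R -> R) : R := \int[mu]_y (om y * f (l y)).

(** Keeping a phase [c] lets a single family, stable under differentiation,
    contain both transforms and their derivatives. *)
Definition trig_moment (k : nat) (c x : R) : R :=
  \int[mu]_y (om y * l y ^+ k * cos (x * l y + c)).

Hypothesis om_ge0 : forall y, 0 <= om y.
Hypothesis mom : measurable_fun setT om.
Hypothesis ml : measurable_fun setT l.
Hypothesis iom : mu.-integrable setT (EFin \o (fun y => om y * (1 + l y ^+ 2))).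

Lemma moment_norm_le k y : (k <= 2)%N ->
  `|om y * l y ^+ k| <= om y * (1 + l y ^+ 2).
Proof.
move=> k2; rewrite normrM ger0_norm// ler_wpM2l// normrX.
have [->|->|->] : [\/ k = 0%N, k = 1%N | k = 2%N].
- by case: k k2 => [|[|[|//]]] _; [constructor 1|constructor 2|constructor 3].
- by rewrite expr0 lerDl sqr_ge0.
- rewrite expr1 -(real_normK (num_real (l y))).
  have := normr_ge0 (l y); move: `|l y| => z z0; nra.
- by rewrite -normrX ger0_norm ?sqr_ge0// lerDr.
Qed.

Lemma measurable_trig k (x c : R) :
  measurable_fun setT (fun y => om y * l y ^+ k * cos (x * l y + c)).
Proof.
apply: measurable_funM.
  by apply: measurable_funM => //; exact: measurable_funX.
apply: (measurableT_comp (continuous_measurable_fun (@continuous_cos R))).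
by apply: measurable_funD => //; apply: measurable_funM.
Qed.

Lemma trig_dominated k (x c : R) y : (k <= 2)%N ->
  `|om y * l y ^+ k * cos (x * l y + c)| <= om y * (1 + l y ^+ 2).
Proof.
move=> k2; rewrite normrM (le_trans _ (moment_norm_le y k2))//.
by rewrite ler_piMr// cos_max.
Qed.

Lemma integrable_trig k (x c : R) : (k <= 2)%N ->
  mu.-integrable setT (EFin \o (fun y => om y * l y ^+ k * cos (x * l y + c))).
Proof.
move=> k2; apply: (integrable_dominated _ iom); first exact: measurable_trig.
by move=> y; exact: trig_dominated.
Qed.

Lemma trig_moment_derive k (c x : R) : (k < 2)%N ->
  is_derive x 1 (trig_moment k c) (trig_moment k.+1 (c + pi / 2) x).
Proof.
move=> k2; pose f (x : R) y := om y * l y ^+ k * cos (x * l y + c).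
have df (z : R) y : is_derive z 1 (f ^~ y)
    (om y * l y ^+ k.+1 * cos (z * l y + (c + pi / 2))).
  have h : is_derive z 1 (fun z : R => c + l y * z) (l y) by exact: is_derive_affine.
  have := is_derive_mul (@is_derive_cst _ _ _ (om y * l y ^+ k) z 1)
    (is_derive_cos_comp h).
  have -> : (fun w => cst (om y * l y ^+ k) w * cos (c + l y * w)) = f ^~ y.
    by apply/funext => w; rewrite /f /cst (mulrC w) (addrC c).
  apply: is_derive_value; rewrite addrA cosDpihalf /cst mulr0 addr0 exprS.
  by rewrite (mulrC z) (addrC c); ring.
have derf z y : `]x - 1, x + 1[%classic z -> setT y -> derivable (f ^~ y) z 1.
  by move=> _ _; case: (df z y).
have d1f z y : partial1of2 f z y = om y * l y ^+ k.+1 * cos (z * l y + (c + pi / 2)).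
  by rewrite /partial1of2 derive1E; case: (df z y).
have Ix : `]x - 1, x + 1[%classic x by rewrite /= in_itv/=; apply/andP; split; lra.
have Gub z y : `]x - 1, x + 1[%classic z -> setT y ->
    `|partial1of2 f z y| <= om y * (1 + l y ^+ 2).
  by move=> _ _; rewrite d1f; exact: trig_dominated.
have intf z : `]x - 1, x + 1[%classic z -> mu.-integrable setT (EFin \o f z).
  by move=> _; apply: integrable_trig; exact: ltnW.
have G0 y : 0 <= om y * (1 + l y ^+ 2) by rewrite mulr_ge0// addr_ge0// sqr_ge0.
apply: DeriveDef.
  exact: (derivable_under_integral measurableT Ix intf derf G0 iom Gub).
rewrite -derive1E.
rewrite (differentiation_under_integral measurableT Ix intf derf G0 iom Gub).
by apply: eq_Rintegral => y _; exact: d1f.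
Qed.

Lemma trig_moment_continuous k (c : R) : (k <= 2)%N -> continuous (trig_moment k c).
Proof.
move=> k2 x; pose f (x : R) y := om y * l y ^+ k * cos (x * l y + c).
have Ix : x \in `]x - 1, x + 1[%classic.
  by apply/mem_set; rewrite /= in_itv/=; apply/andP; split; lra.
apply: (@continuity_under_integral _ _ _ mu f setT measurableT (x-1) (x+1) _ _ _ iom _ x Ix).
- by move=> z _; exact: integrable_trig.
- apply: aeW => y _ z _; apply: cvgM; first exact: cvg_cst.
  apply: (@continuous_comp _ _ _ (fun w : R => w * l y + c) cos z).
    by apply: cvgD; [apply: cvgM; [exact: cvg_id|exact: cvg_cst]|exact: cvg_cst].
  exact: continuous_cos.
- by move=> z _; apply: aeW => y _; exact: trig_dominated.
Qed.

Lemma trig_moment_C2 (c : R) : C2 (trig_moment 0 c).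
Proof.
exists (trig_moment 1 (c + pi / 2)); split; first by move=> x; exact: trig_moment_derive.
exists (trig_moment 2 (c + pi / 2 + pi / 2)); split.
  by move=> x; exact: trig_moment_derive.
exact: trig_moment_continuous.
Qed.

(** The real and imaginary parts of the Fourier transform. *)
Definition cos_transform (x : R) := weighted_int (fun v => cos (x * v)).
Definition sin_transform (x : R) := weighted_int (fun v => sin (x * v)).

Lemma cos_transformE : cos_transform = trig_moment 0 0.
Proof.
by apply/funext => x; apply: eq_Rintegral => y _; rewrite expr0 mulr1 addr0.
Qed.

Lemma sin_transformE : sin_transform = trig_moment 0 (- (pi / 2)).
Proof.
by apply/funext => x; apply: eq_Rintegral => y _; rewrite expr0 mulr1 cosBpihalf.
Qed.

Lemma integrable_om : mu.-integrable setT (EFin \o om).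
Proof.
apply: (integrable_dominated _ iom) => // y.
by have := @moment_norm_le 0 y isT; rewrite expr0 mulr1.
Qed.

Lemma integrable_weighted_int (f : R -> R) (C : R) : measurable_fun setT f ->
  (forall v, `|f v| <= C) -> mu.-integrable setT (EFin \o (fun y => om y * f (l y))).
Proof.
move=> mf fC; apply: (@integrable_dominated _ _ _ _ _ (fun y => C * om y)).
- by apply: measurable_funM => //; exact: measurableT_comp.
- have := @integrableZl _ _ _ mu setT measurableT C _ integrable_om.
  by apply: eq_integrable => // y _.
- by move=> y; rewrite normrM (ger0_norm (om_ge0 y)) mulrC ler_wpM2r.
Qed.

End Weighted.

(** * Decay of oscillatory integrals *)
Section Segment.
Variable R : realType.
Local Notation leb := (@lebesgue_measure R).
Implicit Types f g h F : R -> R.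

Lemma continuous_integrable_segment f (a b : R) : continuous f ->
  leb.-integrable `[a, b] (EFin \o f).
Proof.
move=> cf; apply: continuous_compact_integrable; first exact: segment_compact.
exact: continuous_subspaceT.
Qed.

Lemma Rintegral_derivative F f (a b : R) : a < b ->
  (forall x : R, is_derive x 1 F (f x)) -> continuous f ->
  \int[leb]_(x in `[a, b]) f x = F b - F a.
Proof.
move=> ab dF cf.
have cF : continuous F by apply: C1_continuous; exists f.
rewrite /Rintegral (@continuous_FTC2 _ f F a b) //.
- exact: continuous_subspaceT.
- split.
  + by move=> x _; case: (dF x).
  + by apply: cvg_at_right_filter; exact: cF.
  + by apply: cvg_at_left_filter; exact: cF.
- by move=> x _; rewrite derive1E; case: (dF x).
Qed.

Lemma continuous_segment_bounded f (a b : R) : a <= b -> continuous f ->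
  exists2 B : R, 0 <= B & forall x, a <= x <= b -> `|f x| <= B.
Proof.
move=> ab cf.
have cnf : {within `[a, b], continuous (fun x => `|f x|)}.
  apply: continuous_subspaceT => x.
  by apply: (@continuous_comp _ _ _ f Num.norm x); [exact: cf|exact: norm_continuous].
have [c _ cB] := EVT_max ab cnf.
by exists `|f c| => // x xab; apply: cB; rewrite in_itv.
Qed.

Lemma norm_Rintegral_segment f (a b B : R) : a <= b -> continuous f ->
  (forall x, a <= x <= b -> `|f x| <= B) ->
  `|\int[leb]_(x in `[a, b]) f x| <= B * (b - a).
Proof.
move=> ab cf fB.
apply: (le_trans (le_normr_Rintegral _ _)) => //.
  exact: continuous_integrable_segment.
apply: (@le_trans _ _ (\int[leb]_(x in `[a, b]) B)).
  apply: le_Rintegral => //.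
  - apply: continuous_integrable_segment => x.
    by apply: (@continuous_comp _ _ _ f Num.norm x); [exact: cf|exact: norm_continuous].
  - by apply: (@continuous_integrable_segment (cst B)) => x; exact: cvg_cst.
have lab : fine (leb `[a, b]) = b - a.
  rewrite lebesgue_measure_itv/= lte_fin.
  by case: ltP => //= ba; rewrite (@le_anti _ _ b a)// ?subrr ?ab ?ba.
by rewrite Rintegral_cst// -lab.
Qed.

(** Two integrations by parts.  The boundary terms of order [1 / t] are
    [f A], [h A] and [h 0], which must vanish; [f 0] enters only at order
    [1 / t ^ 2]. *)
Lemma oscillatory_decay f h (A : R) : 0 < A -> C2 f -> C2 h ->
  f A = 0 -> h A = 0 -> h 0 = 0 ->
  exists2 K : R, 0 <= K & forall t : R,
    `|\int[leb]_(x in `[0, A]) (f x * cos (x * t) + h x * sin (x * t))|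
      <= K * (oneDsqr t)^-1.
Proof.
move=> A0 Cf Ch fA hA h0.
have [f1 [df [f2 [df1 cf2]]]] := Cf; have [h1 [dh [h2 [dh1 ch2]]]] := Ch.
have cf := C1_continuous (C2_C1 Cf); have ch := C1_continuous (C2_C1 Ch).
have [a0 a00 a0P] := continuous_segment_bounded (ltW A0) cf.
have [b0 b00 b0P] := continuous_segment_bounded (ltW A0) ch.
have [a2 a20 a2P] := continuous_segment_bounded (ltW A0) cf2.
have [b2 b20 b2P] := continuous_segment_bounded (ltW A0) ch2.
have cosC t : continuous (fun x : R => cos (x * t)).
  move=> x; apply: (@continuous_comp _ _ _ (fun w : R => w * t) cos x).
    by apply: cvgM; [exact: cvg_id|exact: cvg_cst].
  exact: continuous_cos.
have sinC t : continuous (fun x : R => sin (x * t)).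
  move=> x; apply: (@continuous_comp _ _ _ (fun w : R => w * t) sin x).
    by apply: cvgM; [exact: cvg_id|exact: cvg_cst].
  exact: continuous_sin.
have cI g1 g2 t : continuous g1 -> continuous g2 ->
    continuous (fun x => g1 x * cos (x * t) + g2 x * sin (x * t)).
  move=> c1 c2 x; apply: cvgD; apply: cvgM;
    by [exact: c1|exact: c2|exact: cosC|exact: sinC].
have bI g1 g2 (B1 B2 : R) t : (forall x, 0 <= x <= A -> `|g1 x| <= B1) ->
    (forall x, 0 <= x <= A -> `|g2 x| <= B2) ->
    forall x, 0 <= x <= A -> `|g1 x * cos (x * t) + g2 x * sin (x * t)| <= B1 + B2.
  move=> g1B g2B x xA; apply: (le_trans (ler_normD _ _)); apply: lerD.
  - rewrite normrM (le_trans _ (g1B x xA))// ler_piMr// cos_max//.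
  - rewrite normrM (le_trans _ (g2B x xA))// ler_piMr// sin_max//.
pose K1 := `|f1 A| + `|h1 A| + `|f1 0| + (a2 + b2) * (A - 0).
exists ((a0 + b0) * (A - 0) + K1).
  by rewrite /K1 subr0 !addr_ge0// mulr_ge0// ?addr_ge0// ltW.
move=> t; rewrite ler_pdivlMr; last by rewrite (lt_le_trans ltr01)// oneDsqr_ge1.
set I := \int[leb]_(x in _) _.
have I0 : `|I| <= (a0 + b0) * (A - 0).
  apply: norm_Rintegral_segment; [exact: ltW|exact: cI|exact: bI].
pose J := \int[leb]_(x in `[0, A]) (f2 x * cos (x * t) + h2 x * sin (x * t)).
have J0 : `|J| <= (a2 + b2) * (A - 0).
  apply: norm_Rintegral_segment; [exact: ltW|exact: cI|exact: bI].
(* Multiplying by t ^ 2 keeps the primitive meaningful at t = 0. *)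
pose G x := (t * f x * sin (x * t) - t * h x * cos (x * t))
   + (f1 x * cos (x * t) + h1 x * sin (x * t)).
have dG (x : R) : is_derive x 1 G
    (t ^+ 2 * (f x * cos (x * t) + h x * sin (x * t))
     + (f2 x * cos (x * t) + h2 x * sin (x * t))).
  have dx : is_derive x 1 (fun y : R => y * t) t.
    have := is_derive_mul (@is_derive_id _ _ x 1) (@is_derive_cst _ _ _ t x 1).
    by apply: is_derive_value; rewrite mulr0 mulr1 add0r.
  have dc := is_derive_cos_comp dx; have ds := is_derive_sin_comp dx.
  have dtf := is_derive_mul (@is_derive_cst _ _ _ t x 1) (df x).
  have dth := is_derive_mul (@is_derive_cst _ _ _ (- t) x 1) (dh x).
  have := is_derive_add
    (is_derive_add (is_derive_mul dtf ds) (is_derive_mul dth dc))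
    (is_derive_add (is_derive_mul (df1 x) dc) (is_derive_mul (dh1 x) ds)).
  have -> : (fun y => cst t y * f y * sin (y * t) + cst (- t) y * h y * cos (y * t) +
     (f1 y * cos (y * t) + h1 y * sin (y * t))) = G.
    by apply/funext => y; rewrite /G /cst !mulNr.
  by apply: is_derive_value; rewrite /cst /=; ring.
have E : t ^+ 2 * I + J = G A - G 0.
  rewrite -(Rintegral_derivative A0 dG).
    rewrite RintegralD//.
    - rewrite RintegralZl//; exact/continuous_integrable_segment/cI.
    - apply: continuous_integrable_segment => x.
      by apply: cvgM; [exact: cvg_cst|exact: cI].
    - exact/continuous_integrable_segment/cI.
  move=> x; apply: cvgD; last exact: cI.
  by apply: cvgM; [exact: cvg_cst|exact: cI].
have GA : G A - G 0 = f1 A * cos (A * t) + h1 A * sin (A * t) - f1 0.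
  by rewrite /G fA hA h0 mul0r cos0 sin0; ring.
have t2I : `|t ^+ 2 * I| <= K1.
  have -> : t ^+ 2 * I = f1 A * cos (A * t) + h1 A * sin (A * t) - f1 0 - J.
    by rewrite -GA -E addrK.
  apply: (le_trans (ler_normB _ _)); apply: lerD => //.
  apply: (le_trans (ler_normB _ _)); apply: lerD => //.
  apply: (le_trans (ler_normD _ _)); apply: lerD.
    by rewrite normrM ler_piMr// cos_max.
  by rewrite normrM ler_piMr// sin_max.
rewrite /oneDsqr mulrDr mulr1; apply: lerD => //.
by rewrite -(ger0_norm (sqr_ge0 t)) -normrM mulrC.
Qed.

End Segment.

(** * The Fejer kernel *)
Section Fejer.
Variable R : realType.
Local Notation leb := (@lebesgue_measure R).

Lemma continuous_cos_scale (t : R) : continuous (fun x : R => cos (x * t)).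
Proof.
move=> x; apply: (@continuous_comp _ _ _ (fun w : R => w * t) cos x).
  by apply: cvgM; [exact: cvg_id|exact: cvg_cst].
exact: continuous_cos.
Qed.

Lemma continuous_sin_scale (t : R) : continuous (fun x : R => sin (x * t)).
Proof.
move=> x; apply: (@continuous_comp _ _ _ (fun w : R => w * t) sin x).
  by apply: cvgM; [exact: cvg_id|exact: cvg_cst].
exact: continuous_sin.
Qed.

Lemma measurable_cos_scale (t : R) : measurable_fun setT (fun x : R => cos (t * x)).
Proof.
have -> : (fun x : R => cos (t * x)) = (fun x : R => cos (x * t)).
  by apply/funext => x; rewrite mulrC.
exact: (@continuous_measurable_fun R _ (@continuous_cos_scale t)).
Qed.

Lemma measurable_sin_scale (t : R) : measurable_fun setT (fun x : R => sin (t * x)).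
Proof.
have -> : (fun x : R => sin (t * x)) = (fun x : R => sin (x * t)).
  by apply/funext => x; rewrite mulrC.
exact: (@continuous_measurable_fun R _ (@continuous_sin_scale t)).
Qed.

Lemma integrable_oneDsqrV : leb.-integrable setT (EFin \o (fun x => (oneDsqr x)^-1)).
Proof.
have c := @continuous_oneDsqrV R.
have ge0 (x : R) : 0 <= (oneDsqr x)^-1.
  by rewrite invr_ge0 (le_trans ler01)// oneDsqr_ge1.
apply/integrableP; split.
  by apply/measurable_EFinP; exact: continuous_measurable_fun.
under eq_integral do rewrite /= ger0_norm//.
rewrite ge0_symfun_integralT//; last by move=> x; rewrite /oneDsqr/= sqrrN.
rewrite -set_itvcy integral0y_oneDsqr -EFinM; exact: ltry.
Qed.

Lemma continuous_oscillatory (f h : R -> R) (A : R) : 0 < A ->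
  continuous f -> continuous h ->
  continuous (fun t => \int[leb]_(x in `[0, A]) (f x * cos (x * t) + h x * sin (x * t))).
Proof.
move=> A0 cf ch t.
have [a0 a00 a0P] := continuous_segment_bounded (ltW A0) cf.
have [b0 b00 b0P] := continuous_segment_bounded (ltW A0) ch.
have It : t \in `]t - 1, t + 1[%classic.
  by apply/mem_set; rewrite /= in_itv/=; apply/andP; split; lra.
apply: (@continuity_under_integral _ _ _ leb
  (fun t x => f x * cos (x * t) + h x * sin (x * t)) `[0, A]%classic _
  (t-1) (t+1) _ _ (cst (a0 + b0)) _ _ t It) => //.
- move=> z _; apply: continuous_integrable_segment => x.
  apply: cvgD; apply: cvgM;
    by [exact: cf|exact: ch|exact: continuous_cos_scale|exact: continuous_sin_scale].
- apply: aeW => x _ z _; apply: cvgD; apply: cvgM; try exact: cvg_cst.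
  + under eq_fun do rewrite mulrC.
    by rewrite mulrC; exact: continuous_cos_scale.
  + under eq_fun do rewrite mulrC.
    by rewrite mulrC; exact: continuous_sin_scale.
- by apply: (@continuous_integrable_segment _ (cst (a0 + b0))) => x; exact: cvg_cst.
- move=> z _; apply: aeW => x /=; rewrite in_itv/= => xA.
  apply: (le_trans (ler_normD _ _)); apply: lerD.
  + by rewrite normrM (le_trans _ (a0P x xA))// ler_piMr// cos_max.
  + by rewrite normrM (le_trans _ (b0P x xA))// ler_piMr// sin_max.
Qed.

(** The factor 2 accounts for the negative frequencies, which the even
    symmetry of the kernel folds onto [0, A]. *)
Definition triangle (A x : R) : R := 2 + (- (2 / A)) * x.

Definition fejer (A u : R) : R := \int[leb]_(x in `[0, A]) (triangle A x * cos (x * u)).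

Variable A : R.
Hypothesis A0 : 0 < A.

Lemma triangleA : triangle A A = 0.
Proof. by rewrite /triangle; field; rewrite gt_eqF. Qed.

Lemma triangle_ge0 x : 0 <= x <= A -> 0 <= triangle A x.
Proof.
move=> /andP[x0 xA]; rewrite /triangle mulNr subr_ge0 -mulrA mulrC.
by rewrite -ler_pdivlMr// divff// mulrC ler_pdivrMr// mul1r.
Qed.

Lemma triangle_C2 : C2 (triangle A).
Proof. exact: C2_affine. Qed.

Lemma continuous_triangle : continuous (triangle A).
Proof. exact: C1_continuous (C2_C1 triangle_C2). Qed.

Lemma continuous_fejer_integrand u : continuous (fun x => triangle A x * cos (x * u)).
Proof.
by move=> x; apply: cvgM; [exact: continuous_triangle|exact: continuous_cos_scale].
Qed.

Lemma fejer_oscillatory : fejer A =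
  fun u => \int[leb]_(x in `[0, A]) (triangle A x * cos (x * u) + (0 + 0 * x) * sin (x * u)).
Proof.
by apply/funext => u; apply: eq_Rintegral => x _; rewrite mul0r addr0 mul0r addr0.
Qed.

Lemma continuous_fejer : continuous (fejer A).
Proof.
rewrite fejer_oscillatory; apply: (@continuous_oscillatory _ (fun x => 0 + 0 * x)) => //.
  exact: continuous_triangle.
exact: C1_continuous (C1_affine 0 0).
Qed.

Lemma fejer_decay : exists2 K : R, 0 <= K &
  forall u, `|fejer A u| <= K * (oneDsqr u)^-1.
Proof.
rewrite fejer_oscillatory; apply: (@oscillatory_decay _ _ (fun x => 0 + 0 * x)) => //.
- exact: triangle_C2.
- exact: C2_affine.
- exact: triangleA.
- by rewrite mul0r addr0.
- by rewrite mul0r addr0.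
Qed.

Lemma fejer_integrable : leb.-integrable setT (EFin \o fejer A).
Proof.
have [K K0 KP] := fejer_decay.
apply: (@integrable_dominated _ _ _ leb (fejer A) (fun u : R => K * (oneDsqr u)^-1)) => //.
  exact: (continuous_measurable_fun continuous_fejer).
have := @integrableZl _ _ _ leb setT measurableT K _ integrable_oneDsqrV.
by apply: eq_integrable => // y _.
Qed.

(** The closed form [2 (1 - cos (A u)) / (A u ^ 2)], which shows nonnegativity
    and decay away from the origin. *)
Lemma fejerE u : u ^+ 2 * fejer A u = 2 / A * (1 - cos (A * u)).
Proof.
pose G x := u * triangle A x * sin (x * u) + (- (2 / A)) * cos (x * u).
have dG (x : R) : is_derive x 1 G (u ^+ 2 * (triangle A x * cos (x * u))).
  have dx : is_derive x 1 (fun y : R => y * u) u.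
    have := is_derive_mul (@is_derive_id _ _ x 1) (@is_derive_cst _ _ _ u x 1).
    by apply: is_derive_value; rewrite mulr0 mulr1 add0r.
  have dc := is_derive_cos_comp dx; have ds := is_derive_sin_comp dx.
  have dt := is_derive_mul (@is_derive_cst _ _ _ u x 1) (is_derive_affine 2 (- (2 / A)) x).
  have := is_derive_add (is_derive_mul dt ds)
     (is_derive_mul (@is_derive_cst _ _ _ (- (2 / A)) x 1) dc).
  by apply: is_derive_value; rewrite /cst /triangle /=; ring.
rewrite /fejer -RintegralZl//; last first.
  exact/continuous_integrable_segment/continuous_fejer_integrand.
rewrite (Rintegral_derivative A0 dG); last first.
  by move=> x; apply: cvgM; [exact: cvg_cst|exact: continuous_fejer_integrand].
rewrite /G triangleA mul0r cos0 sin0; ring.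
Qed.

Lemma fejer_ge0 u : 0 <= fejer A u.
Proof.
have [->|u0] := eqVneq u 0.
  apply: Rintegral_ge0 => x /=; rewrite in_itv/= => xA.
  by rewrite mulr0 cos0 mulr1 triangle_ge0.
rewrite -(@pmulr_rge0 _ (u ^+ 2)) ?exprn_even_gt0// fejerE.
by apply: mulr_ge0; [rewrite divr_ge0// ltW|rewrite subr_ge0 cos_le1].
Qed.

Lemma fejer_tail u : u ^+ 2 * fejer A u <= 4 / A.
Proof.
rewrite fejerE (_ : 4 / A = 2 / A * 2); last by rewrite mulrAC -natrM.
by rewrite ler_pM2l ?divr_gt0//; have := cos_geN1 (A * u); lra.
Qed.

End Fejer.

Section FejerMass.
Variable R : realType.
Local Notation leb := (@lebesgue_measure R).

(** A bound uniform in [A]: the kernel is at least a multiple of [A] on an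
    interval of length [1 / A]. *)
Lemma fejer_mass : exists2 c : R, 0 < c &
  forall A : R, 0 < A -> c <= \int[leb]_u fejer A u.
Proof.
have le2 : - 2^-1 <= 2^-1 :> R by lra.
have ccos : {within `[- 2^-1, 2^-1], continuous (@cos R)}.
  by apply: continuous_subspaceT; exact: continuous_cos.
have [c cI cP] := EVT_min le2 ccos.
have c0 : 0 < cos c.
  move: cI; rewrite in_itv/= => /andP[c1 c2].
  have pi1 := pihalf_ge1 R.
  by apply: cos_gt0_pihalf; apply/andP; split; lra.
exists (cos c) => // A A0.
pose r := (2 * A)^-1.
have r0 : 0 < r by rewrite invr_gt0 mulr_gt0.
have Ar : A * r = 2^-1 by rewrite /r; field; rewrite gt_eqF.
pose B : set R := `[- r, r]%classic.
have lebB : fine (leb B) = r + r.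
  by rewrite /B lebesgue_measure_itv/= lte_fin gtrN//= opprK.
have triE : \int[leb]_(x in `[0, A]) triangle A x = A.
  pose G (x : R) := 2 * x + (- A^-1) * (x * x).
  have dG (x : R) : is_derive x 1 G (triangle A x).
    have := is_derive_add
      (is_derive_mul (@is_derive_cst _ _ _ (2 : R) x 1) (@is_derive_id _ _ x 1))
      (is_derive_mul (@is_derive_cst _ _ _ (- A^-1) x 1)
         (is_derive_mul (@is_derive_id _ _ x 1) (@is_derive_id _ _ x 1))).
    by apply: is_derive_value; rewrite /cst /triangle /=; ring.
  rewrite (Rintegral_derivative A0 dG); last exact: continuous_triangle.
  by rewrite /G; field; rewrite gt_eqF.
have low u : B u -> A * cos c <= fejer A u.
  rewrite /B/= in_itv/= => /andP[u1 u2].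
  rewrite -{1}triE -RintegralZr//; last first.
    exact/continuous_integrable_segment/continuous_triangle.
  apply: le_Rintegral => //.
  - apply: continuous_integrable_segment => x.
    by apply: cvgM; [exact: continuous_triangle|exact: cvg_cst].
  - exact/continuous_integrable_segment/continuous_fejer_integrand.
  move=> x /=; rewrite in_itv/= => xA; rewrite ler_wpM2l ?triangle_ge0//.
  apply: cP; rewrite in_itv/=; case/andP: xA => x0 xA.
  have : `|x * u| <= 2^-1.
    rewrite normrM (ger0_norm x0) -Ar; apply: ler_pM => //.
    by rewrite ler_norml u1 u2.
  by rewrite ler_norml.
have iB : leb.-integrable B (EFin \o cst (A * cos c)).
  by apply: continuous_integrable_segment => x; exact: cvg_cst.
apply: (@le_trans _ _ (\int[leb]_(u in B) (A * cos c))).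
  suff : cos c <= A * cos c * (r + r).
    by move=> H; rewrite Rintegral_cst; [move: H; rewrite -lebB|exact: measurable_itv].
  rewrite (_ : A * cos c * (r + r) = 2 * (A * r) * cos c); last by ring.
  by rewrite Ar divff ?mul1r.
apply: (@le_trans _ _ (\int[leb]_(u in B) fejer A u)).
  apply: le_Rintegral => //; first exact: measurable_itv.
  exact: continuous_integrable_segment (continuous_fejer A0).
rewrite Rintegral_mkcond; apply: le_Rintegral => //.
- have : leb.-integrable B (EFin \o fejer A).
    exact: continuous_integrable_segment (continuous_fejer A0).
  by rewrite -restrict_EFin; apply: (integrable_mkcond _ _).1; exact: measurable_itv.
- exact: fejer_integrable.
- move=> u _; rewrite patchE; case: ifP => // _; exact: fejer_ge0.
Qed.

End FejerMass.

(** * Dividing by the transform *)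
Section Deconvolution.
Context d (T : measurableType d) (R : realType).
Variable mu : {sigma_finite_measure set T -> \bar R}.
Variables (om l : T -> R).
Hypothesis om_ge0 : forall y, 0 <= om y.
Hypothesis mom : measurable_fun setT om.
Hypothesis ml : measurable_fun setT l.
Hypothesis iom : mu.-integrable setT (EFin \o (fun y => om y * (1 + l y ^+ 2))).
Local Notation leb := (@lebesgue_measure R).
Local Notation wint := (weighted_int mu om l).
Local Notation wcos := (cos_transform mu om l).
Local Notation wsin := (sin_transform mu om l).
Hypothesis nonvanishing : forall x, wcos x ^+ 2 + wsin x ^+ 2 != 0.

Let iom0 := integrable_om om_ge0 mom iom.

(** The inverse of [cos_transform + i sin_transform] is [inv_re - i inv_im]. *)
Definition inv_re (x : R) := wcos x * (wcos x * wcos x + wsin x * wsin x)^-1.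
Definition inv_im (x : R) := wsin x * (wcos x * wcos x + wsin x * wsin x)^-1.

Lemma cos_transform_C2 : C2 wcos.
Proof. by rewrite cos_transformE; exact: trig_moment_C2. Qed.

Lemma sin_transform_C2 : C2 wsin.
Proof. by rewrite sin_transformE; exact: trig_moment_C2. Qed.

Let normsq_neq0 x : wcos x * wcos x + wsin x * wsin x != 0.
Proof. by rewrite -!expr2. Qed.

Let normsq_C2 : C2 (fun x => (wcos x * wcos x + wsin x * wsin x)^-1).
Proof.
apply: C2V => //; apply: C2D; apply: C2M;
  by [exact: cos_transform_C2|exact: sin_transform_C2].
Qed.

Lemma inv_re_C2 : C2 inv_re.
Proof. by apply: C2M => //; exact: cos_transform_C2. Qed.

Lemma inv_im_C2 : C2 inv_im.
Proof. by apply: C2M => //; exact: sin_transform_C2. Qed.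

Lemma sin_transform0 : wsin 0 = 0.
Proof.
rewrite /wsin /wint (@eq_Rintegral _ _ _ _ _ (fun=> 0)); last first.
  by move=> y _; rewrite mul0r sin0 mulr0.
by rewrite Rintegral_cst// mul0r.
Qed.

Variable A : R.
Hypothesis A0 : 0 < A.

Let f x := triangle A x * inv_re x.
Let h x := triangle A x * inv_im x.

Let Cf : C2 f. Proof. exact: C2M (triangle_C2 A) inv_re_C2. Qed.
Let Ch : C2 h. Proof. exact: C2M (triangle_C2 A) inv_im_C2. Qed.

Definition deconv (t : R) : R :=
  \int[leb]_(x in `[0, A]) (f x * cos (x * t) + h x * sin (x * t)).

Lemma deconv_decay : exists2 K : R, 0 <= K &
  forall t, `|deconv t| <= K * (oneDsqr t)^-1.
Proof.
apply: oscillatory_decay => //.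
- by rewrite /f triangleA// mul0r.
- by rewrite /h triangleA// mul0r.
- by rewrite /h /inv_im sin_transform0 mul0r mulr0.
Qed.

Lemma continuous_deconv : continuous deconv.
Proof.
apply: continuous_oscillatory => //.
  exact: C1_continuous (C2_C1 Cf).
exact: C1_continuous (C2_C1 Ch).
Qed.

Lemma measurable_deconv : measurable_fun setT deconv.
Proof. exact: continuous_measurable_fun continuous_deconv. Qed.

Lemma deconv_bounded : exists2 K : R, 0 <= K & forall t, `|deconv t| <= K.
Proof.
have [K K0 KP] := deconv_decay; exists K => // t.
by rewrite (le_trans (KP t))// ler_piMr// invf_le1 ?oneDsqr_ge1// (lt_le_trans ltr01)// oneDsqr_ge1.
Qed.

Lemma integrable_deconv : leb.-integrable setT (EFin \o deconv).
Proof.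
have [K K0 KP] := deconv_decay.
apply: (@integrable_dominated _ _ _ leb deconv (fun u : R => K * (oneDsqr u)^-1)) => //.
  exact: measurable_deconv.
have := @integrableZl _ _ _ leb setT measurableT K _ (@integrable_oneDsqrV R).
by apply: eq_integrable => // y _.
Qed.

(** Frequency by frequency, convolving with the weight multiplies by its
    transform, which the factors in [f] and [h] cancel. *)
Lemma weighted_int_trig_shift x u :
  wint (fun v => f x * cos (x * (u + v)) + h x * sin (x * (u + v)))
  = triangle A x * cos (x * u).
Proof.
have ic : mu.-integrable setT (EFin \o (fun y => om y * cos (x * l y))).
  apply: (@integrable_weighted_int _ _ _ mu om l om_ge0 mom ml iom (fun v => cos (x * v)) 1).
    exact: measurable_cos_scale.
  by move=> v; exact: cos_max.
have is_ : mu.-integrable setT (EFin \o (fun y => om y * sin (x * l y))).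
  apply: (@integrable_weighted_int _ _ _ mu om l om_ge0 mom ml iom (fun v => sin (x * v)) 1).
    exact: measurable_sin_scale.
  by move=> v; exact: sin_max.
pose a1 := f x * cos (x * u) + h x * sin (x * u).
pose a2 := h x * cos (x * u) - f x * sin (x * u).
have iZ (c : R) g : mu.-integrable setT (EFin \o g) ->
    mu.-integrable setT (EFin \o (fun y : T => c * g y)).
  move=> ig; have := @integrableZl _ _ _ mu setT measurableT c _ ig.
  by apply: eq_integrable => // y _.
rewrite /wint (@eq_Rintegral _ _ _ _ _ (fun y => a1 * (om y * cos (x * l y)) + a2 * (om y * sin (x * l y)))); last first.
  move=> y _; rewrite !(mulrDr x) cosD sinD /a1 /a2; ring.
rewrite RintegralD ?RintegralZl//; [|exact: iZ..].
rewrite -[\int[mu]_y (om y * cos (x * l y))]/(wcos x).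
rewrite -[\int[mu]_y (om y * sin (x * l y))]/(wsin x).
rewrite /a1 /a2 /f /h /inv_re /inv_im; field.
exact: normsq_neq0.
Qed.

(** Once the two integrations are exchanged, [weighted_int_trig_shift] applies
    at each frequency. *)
Lemma weighted_int_deconv u : wint (fun v => deconv (u + v)) = fejer A u.
Proof.
have mf : measurable_fun setT f by exact: continuous_measurable_fun (C1_continuous (C2_C1 Cf)).
have mh : measurable_fun setT h by exact: continuous_measurable_fun (C1_continuous (C2_C1 Ch)).
pose fr := f \_ `[0, A]; pose hr := h \_ `[0, A].
have mfr : measurable_fun setT fr.
  by apply/measurable_restrict => //; rewrite setTI; exact: measurable_funS mf.
have mhr : measurable_fun setT hr.
  by apply/measurable_restrict => //; rewrite setTI; exact: measurable_funS mh.
pose F (x : R) y := om y * (fr x * cos (x * (u + l y)) + hr x * sin (x * (u + l y))).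
have [a0 a00 a0P] := continuous_segment_bounded (ltW A0) (C1_continuous (C2_C1 Cf)).
have [b0 b00 b0P] := continuous_segment_bounded (ltW A0) (C1_continuous (C2_C1 Ch)).
pose a := (cst (a0 + b0) : R -> R) \_ `[0, A].
have ia : leb.-integrable setT (EFin \o a).
  rewrite -restrict_EFin; apply: (integrable_mkcond _ _).1; first exact: measurable_itv.
  by apply: (@continuous_integrable_segment _ (cst (a0 + b0))) => x; exact: cvg_cst.
have Fab x y : `|F x y| <= a x * om y.
  rewrite /F /fr /hr /a !patchE normrM (ger0_norm (om_ge0 y)) mulrC ler_wpM2r//.
  case: ifPn => [/set_mem|_] /=; last by rewrite !mul0r addr0 normr0.
  rewrite in_itv/= => xA; apply: (le_trans (ler_normD _ _)); apply: lerD.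
  + by rewrite normrM (le_trans _ (a0P x xA))// ler_piMr// cos_max.
  + by rewrite normrM (le_trans _ (b0P x xA))// ler_piMr// sin_max.
have marg : measurable_fun setT (fun z : measurableTypeR R * T => z.1 * (u + l z.2)).
  apply: measurable_funM; first exact: measurable_fst.
  by apply: measurable_funD => //; apply: (measurableT_comp ml); exact: measurable_snd.
have mF : measurable_fun setT (fun z : measurableTypeR R * T => F z.1 z.2).
  apply: measurable_funM; first exact: (measurableT_comp mom measurable_snd).
  apply: measurable_funD; apply: measurable_funM.
  - exact: (measurableT_comp mfr measurable_fst).
  - exact: (measurableT_comp (continuous_measurable_fun (@continuous_cos R)) marg).
  - exact: (measurableT_comp mhr measurable_fst).
  - exact: (measurableT_comp (continuous_measurable_fun (@continuous_sin R)) marg).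
have := dominated_exchange mF ia iom0 Fab.
have -> : \int[leb]_x \int[mu]_y F x y = fejer A u.
  rewrite /fejer [RHS]Rintegral_mkcond; apply: eq_Rintegral => x _.
  rewrite patchE /F /fr /hr !patchE; case: ifPn => xA.
    by rewrite -[LHS]/(wint (fun v => f x * cos (x * (u + v)) + h x * sin (x * (u + v)))) weighted_int_trig_shift.
  rewrite (@eq_Rintegral _ _ _ _ _ (fun=> 0)); first by rewrite Rintegral_cst// mul0r.
  by move=> y _; rewrite /= !mul0r addr0 mulr0.
move=> ->; apply: eq_Rintegral => y _.
rewrite /deconv Rintegral_mkcond -RintegralZl//; last first.
  rewrite -restrict_EFin; apply: (integrable_mkcond _ _).1; first exact: measurable_itv.
  apply: continuous_integrable_segment => x.
  apply: cvgD; apply: cvgM.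
  - exact: (C1_continuous (C2_C1 Cf)).
  - exact: continuous_cos_scale.
  - exact: (C1_continuous (C2_C1 Ch)).
  - exact: continuous_sin_scale.
apply: eq_Rintegral => x _; rewrite /F /fr /hr !patchE; case: ifPn => // _.
by rewrite /= !mul0r addr0.
Qed.

(** Fubini and the translation invariance of the Lebesgue measure move the
    weight from [k] to [deconv]. *)
Lemma deconv_fejer_pairing (k : R -> R) (C : R) :
  measurable_fun setT k -> (forall u, `|k u| <= C) ->
  measurable_fun setT (fun t => deconv t * wint (fun v => k (t - v))) /\
  \int[leb]_t (deconv t * wint (fun v => k (t - v))) = \int[leb]_u (k u * fejer A u).
Proof.
move=> mk kC; have C0 : 0 <= C by rewrite (le_trans _ (kC 0)).
have md := measurable_deconv.
have [K K0 KP] := deconv_bounded.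
pose F1 (t : R) y := deconv t * (om y * k (t - l y)).
have mF1 : measurable_fun setT (fun z : measurableTypeR R * T => F1 z.1 z.2).
  apply: measurable_funM; first exact: (measurableT_comp md measurable_fst).
  apply: measurable_funM; first exact: (measurableT_comp mom measurable_snd).
  apply: (measurableT_comp mk); apply: measurable_funB; first exact: measurable_fst.
  exact: (measurableT_comp ml measurable_snd).
have ia1 : leb.-integrable setT (EFin \o (fun t => C * `|deconv t|)).
  have := @integrableZl _ _ _ leb setT measurableT C _ (integrable_abse integrable_deconv).
  by apply: eq_integrable => // y _.
have F1ab t y : `|F1 t y| <= (C * `|deconv t|) * om y.
  rewrite /F1 !normrM (ger0_norm (om_ge0 y)).
  have := kC (t - l y); have := om_ge0 y; have := normr_ge0 (deconv t).
  move: `|k _| `|deconv t| (om y) => p q r q0 r0 pC.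
  by have := ler_wpM2l (mulr_ge0 q0 r0) pC; lra.
pose F2 (u : R) y := om y * (deconv (u + l y) * k u).
have mF2 : measurable_fun setT (fun z : measurableTypeR R * T => F2 z.1 z.2).
  apply: measurable_funM; first exact: (measurableT_comp mom measurable_snd).
  apply: measurable_funM; last exact: (measurableT_comp mk measurable_fst).
  apply: (measurableT_comp md); apply: measurable_funD; first exact: measurable_fst.
  exact: (measurableT_comp ml measurable_snd).
have s1 u : mu.-integrable setT (EFin \o F2 u).
  apply: (@integrable_weighted_int _ _ _ mu om l om_ge0 mom ml iom (fun v => deconv (u + v) * k u) (K * C)).
    apply: measurable_funM => //; apply: (measurableT_comp md); exact: measurable_funD.
  by move=> v; rewrite normrM; apply: ler_pM.
have sh y : leb.-integrable setT (EFin \o (fun u => deconv (u + l y))).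
  exact: integrable_translation integrable_deconv.
have s2' y : leb.-integrable setT (EFin \o (fun u => C * om y * `|deconv (u + l y)|)).
  have := @integrableZl _ _ _ leb setT measurableT (C * om y) _ (integrable_abse (sh y)).
  by apply: eq_integrable => // u _.
have F2C u y : `|F2 u y| <= C * om y * `|deconv (u + l y)|.
  rewrite /F2 !normrM (ger0_norm (om_ge0 y)).
  have := kC u; have := om_ge0 y; have := normr_ge0 (deconv (u + l y)).
  move: `|k _| `|deconv _| (om y) => p q r q0 r0 pC.
  by have := ler_wpM2l (mulr_ge0 q0 r0) pC; lra.
have s2 y : leb.-integrable setT (EFin \o F2 ^~ y).
  apply: (integrable_dominated _ (s2' y)) => //.
  exact: (measurableT_comp mF2 (pair2_measurable y)).
pose D := \int[leb]_u `|deconv u|.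
have ib : mu.-integrable setT (EFin \o (fun y => C * D * om y)).
  have := @integrableZl _ _ _ mu setT measurableT (C * D) _ iom0.
  by apply: eq_integrable => // y _.
have F2b y : \int[leb]_u `|F2 u y| <= C * D * om y.
  have -> : C * D * om y = \int[leb]_u (C * om y * `|deconv (u + l y)|).
    rewrite RintegralZl//; last first.
      by have := integrable_abse (sh y); exact: eq_integrable.
    rewrite (@Rintegral_translation R (fun u => `|deconv u|)) -/D; first by ring.
    by have := integrable_abse integrable_deconv; exact: eq_integrable.
  apply: le_Rintegral => //.
  by have := integrable_abse (s2 y); exact: eq_integrable.
have E2 := Rintegral_exchange mF2 s1 s2 ib F2b.
have E1 := dominated_exchange mF1 ia1 iom0 F1ab.
have slice t : \int[mu]_y F1 t y = deconv t * wint (fun v => k (t - v)).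
  rewrite /F1 RintegralZl//.
  apply: (@integrable_weighted_int _ _ _ mu om l om_ge0 mom ml iom (fun v => k (t - v)) C) => //.
  by apply: (measurableT_comp mk); exact: measurable_funB.
split.
  by under eq_fun do rewrite -slice; exact: (measurable_dominated_slice mF1 ia1 iom0 F1ab).
transitivity (\int[leb]_t \int[mu]_y F1 t y).
  by apply: eq_Rintegral => t _; rewrite slice.
rewrite E1; transitivity (\int[leb]_u \int[mu]_y F2 u y); last first.
  apply: eq_Rintegral => u _; rewrite -weighted_int_deconv /wint -RintegralZl//.
    by apply: eq_Rintegral => y _; rewrite /F2; ring.
  apply: (@integrable_weighted_int _ _ _ mu om l om_ge0 mom ml iom (fun v => deconv (u + v)) K) => //.
  by apply: (measurableT_comp md); exact: measurable_funD.
rewrite E2; apply: eq_Rintegral => y _.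
rewrite -(@Rintegral_translation R (F1 ^~ y) (l y)).
  apply: eq_Rintegral => u _; rewrite /F1 /F2 addrK; ring.
exact: (dominated_slice2 mF1 ia1 F1ab y).
Qed.

End Deconvolution.

(** * Bounded kernels whose convolution with the weight tends to one *)
Lemma fejer_off_center (R : realType) (A eta u : R) : 0 < A -> 0 < eta ->
  eta <= `|u| ->
  fejer A u <= 4 / A * ((1 + eta ^+ 2) / eta ^+ 2) * (oneDsqr u)^-1.
Proof.
move=> A0 e0 eu.
have e2 : 0 < eta ^+ 2 by rewrite exprn_gt0.
have eu2 : eta ^+ 2 <= u ^+ 2.
  by rewrite -(real_normK (num_real u)) lerXn2r ?nnegrE// ltW.
have u2 : 0 < u ^+ 2 by exact: lt_le_trans eu2.
rewrite ler_pdivlMr; last by rewrite (lt_le_trans ltr01)// oneDsqr_ge1.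
apply: (@le_trans _ _ (fejer A u * (u ^+ 2 * ((1 + eta ^+ 2) / eta ^+ 2)))).
  rewrite ler_wpM2l ?fejer_ge0// mulrA ler_pdivlMr// /oneDsqr.
  by rewrite mulrDl mulrDr mul1r mulr1 lerD2r.
rewrite mulrA (mulrC (fejer A u)) ler_wpM2r ?fejer_tail//.
by rewrite divr_ge0 ?addr_ge0 ?ltW.
Qed.

Section KernelSequence.
Context d (T : measurableType d) (R : realType).
Variable mu : {sigma_finite_measure set T -> \bar R}.
Variables (om l : T -> R).
Hypothesis om_ge0 : forall y, 0 <= om y.
Hypothesis mom : measurable_fun setT om.
Hypothesis ml : measurable_fun setT l.
Hypothesis iom : mu.-integrable setT (EFin \o (fun y => om y * (1 + l y ^+ 2))).
Local Notation leb := (@lebesgue_measure R).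
Local Notation wint := (weighted_int mu om l).
Hypothesis nonvanishing :
  forall x, cos_transform mu om l x ^+ 2 + sin_transform mu om l x ^+ 2 != 0.

Variables (k : nat -> R -> R) (C al : R).
Hypothesis al_ge0 : 0 <= al.
Hypothesis mk : forall n, measurable_fun setT (k n).
Hypothesis k_ge0 : forall n u, 0 <= k n u.
Hypothesis kC : forall n u, k n u <= C.
Hypothesis k_growth : forall n (u s : R), 0 <= s -> k n (u + s) <= expR (al * s) * k n u.
Hypothesis k_cvg : forall t, wint (fun v => k n (t - v)) @[n --> \oo] --> (1 : R).

Let W : R := \int[mu]_y om y.
Let iom0 := integrable_om om_ge0 mom iom.

(** The transform at frequency 0 is the total mass. *)
Lemma mass_gt0 : 0 < W.
Proof.
have W0 : 0 <= W by exact: Rintegral_ge0.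
rewrite lt_def W0 andbT; apply/negP => /eqP W00.
have /negP := nonvanishing 0; apply.
rewrite sin_transform0 expr0n addr0 sqrf_eq0 /cos_transform /wint.
under eq_Rintegral do rewrite mul0r cos0 mulr1.
exact/eqP.
Qed.

Let norm_k n u : `|k n u| <= C.
Proof. by rewrite ger0_norm. Qed.

Let C_ge0 : 0 <= C.
Proof. exact: le_trans (k_ge0 0%N 0) (kC 0%N 0). Qed.

(** The pairing with [k = 1]. *)
Lemma deconv_mass (A : R) : 0 < A ->
  \int[leb]_t deconv mu om l A t = (\int[leb]_u fejer A u) / W.
Proof.
move=> A0; have Wn0 : W != 0 by rewrite gt_eqF// mass_gt0.
have c1 : forall u : R, `|cst (1 : R) u| <= 1 by move=> u; rewrite normr1.
have [_] := deconv_fejer_pairing om_ge0 mom ml iom nonvanishing A0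
  (@measurable_cst _ _ _ _ setT (1 : R)) c1.
rewrite /wint /cst; under [in RHS]eq_Rintegral do rewrite mul1r.
move=> <-; under [in RHS]eq_Rintegral do
  under eq_Rintegral do rewrite mulr1.
rewrite RintegralZr//; last exact: integrable_deconv.
by rewrite -/W mulfK.
Qed.

Lemma k_fejer_cvg (A s : R) : 0 < A ->
  \int[leb]_u (k n (u + s) * fejer A u) @[n --> \oo] --> (\int[leb]_u fejer A u) / W.
Proof.
move=> A0; rewrite -deconv_mass//.
have mks n : measurable_fun setT (fun u : R => k n (u + s)).
  by apply: (measurableT_comp (mk n)); exact: measurable_funD.
have pair n := deconv_fejer_pairing om_ge0 mom ml iom nonvanishing A0
  (mks n) (fun u => norm_k n (u + s)).
under eq_fun => n do rewrite -(pair n).2.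
apply: (@Rintegral_dominated_cvg _ _ _ leb _ _
  (fun t => C * W * `|deconv mu om l A t|)).
- by move=> n; exact: (pair n).1.
- move=> t; rewrite -[X in _ --> X]mulr1; apply: cvgM; first exact: cvg_cst.
  have := k_cvg (t + s).
  by under eq_fun do under eq_fun do rewrite addrAC.
- have := @integrableZl _ _ _ leb setT measurableT (C * W) _
    (integrable_abse (integrable_deconv om_ge0 mom ml iom nonvanishing A0)).
  by apply: eq_integrable => // y _.
- move=> n t; rewrite normrM mulrC ler_wpM2r//.
  have iC : mu.-integrable setT (EFin \o (fun y => C * om y)).
    have := @integrableZl _ _ _ mu setT measurableT C _ iom0.
    by apply: eq_integrable => // y _.
  rewrite /W -RintegralZl//; apply: norm_Rintegral_le => //.
    apply: measurable_funM => //; apply: (measurableT_comp (mks n)).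
    exact: measurable_funB.
  by move=> y; rewrite normrM (ger0_norm (om_ge0 y)) mulrC ler_wpM2r.
Qed.

Let Pi : R := \int[leb]_u (oneDsqr u)^-1.
Let Keta (eta A : R) := 4 / A * ((1 + eta ^+ 2) / eta ^+ 2).

Let Keta_ge0 eta A : 0 < A -> 0 <= Keta eta A.
Proof.
by move=> A0; rewrite mulr_ge0// ?divr_ge0// ?addr_ge0 ?sqr_ge0// ltW.
Qed.

Let oneV_ge0 (u : R) : 0 <= (oneDsqr u)^-1.
Proof. by rewrite invr_ge0 (le_trans ler01)// oneDsqr_ge1. Qed.

Let Pi_ge0 : 0 <= Pi.
Proof. exact: Rintegral_ge0. Qed.

Let intZ (c : R) (g : R -> R) : leb.-integrable setT (EFin \o g) ->
  leb.-integrable setT (EFin \o (fun y => c * g y)).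
Proof.
move=> ig; have := @integrableZl _ _ _ leb setT measurableT c _ ig.
by apply: eq_integrable => // y _.
Qed.

Let intD (f g : R -> R) : leb.-integrable setT (EFin \o f) ->
  leb.-integrable setT (EFin \o g) ->
  leb.-integrable setT (EFin \o (fun y => f y + g y)).
Proof.
move=> jf ig; have := @integrableD _ _ _ leb setT measurableT _ _ jf ig.
by apply: eq_integrable => // y _.
Qed.

Let int_kfejer n s A : 0 < A ->
  leb.-integrable setT (EFin \o (fun u => k n (u + s) * fejer A u)).
Proof.
move=> A0; apply: (@integrable_dominated _ _ _ leb _ (fun u => C * fejer A u)).
- apply: measurable_funM; last exact: integrable_measurable (fejer_integrable A0).
  by apply: (measurableT_comp (mk n)); exact: measurable_funD.
- exact/intZ/fejer_integrable.
- by move=> u; rewrite normrM (ger0_norm (fejer_ge0 A0 u)) ler_wpM2r// fejer_ge0.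
Qed.

(** Inside the window [`|u| <= eta] the growth condition compares [k] at
    [u - eta <= 0] with [k] at 0; outside, the kernel is small and [k] is
    bounded.  Shifting by [eta] puts the whole window on one side of 0, where
    the growth condition gives a bound in the right direction. *)
Lemma k_fejer_lower n (A eta : R) : 0 < A -> 0 < eta ->
  k n 0 * ((\int[leb]_u fejer A u) - Keta eta A * Pi) <=
  expR (al * (2 * eta)) * \int[leb]_u (k n (u + - eta) * fejer A u).
Proof.
move=> A0 e0.
have jf := fejer_integrable A0; have io := @integrable_oneDsqrV R.
have -> : (\int[leb]_u fejer A u) - Keta eta A * Pi =
    \int[leb]_u (fejer A u + (- Keta eta A) * (oneDsqr u)^-1).
  by rewrite RintegralD// ?RintegralZl// ?mulNr//; exact: intZ.
rewrite -RintegralZl//; last by apply: intD => //; exact: intZ.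
rewrite -RintegralZl//; last exact: int_kfejer.
apply: le_Rintegral => //.
- by apply: intZ; apply: intD => //; exact: intZ.
- exact/intZ/int_kfejer.
move=> u _; have phi0 := fejer_ge0 A0 u.
have [ue|ue] := lerP `|u| eta; last first.
  apply: (@le_trans _ _ 0); last first.
    by apply: mulr_ge0; [exact: expR_ge0|exact: mulr_ge0].
  apply: mulr_ge0_le0 => //.
  by rewrite mulNr subr_le0 fejer_off_center// ltW.
apply: (@le_trans _ _ (k n 0 * fejer A u)).
  by rewrite ler_wpM2l// mulNr gerBl mulr_ge0// Keta_ge0.
rewrite mulrA ler_wpM2r//.
move: ue; rewrite ler_norml => /andP[u1 u2].
have s0 : 0 <= eta - u by rewrite subr_ge0.
have := k_growth n (u - eta) s0; rewrite (_ : u - eta + (eta - u) = 0); last by ring.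
move/le_trans; apply; rewrite ler_wpM2r// ler_expR ler_wpM2l//; lra.
Qed.

Lemma k_fejer_upper n (A eta : R) : 0 < A -> 0 < eta ->
  \int[leb]_u (k n (u + eta) * fejer A u) <=
  expR (al * (2 * eta)) * k n 0 * (\int[leb]_u fejer A u) + C * (Keta eta A * Pi).
Proof.
move=> A0 e0.
have jf := fejer_integrable A0; have io := @integrable_oneDsqrV R.
have -> : expR (al * (2 * eta)) * k n 0 * (\int[leb]_u fejer A u) + C * (Keta eta A * Pi)
  = \int[leb]_u (expR (al * (2 * eta)) * k n 0 * fejer A u + C * Keta eta A * (oneDsqr u)^-1).
  by rewrite RintegralD// ?RintegralZl// ?mulrA//; exact: intZ.
apply: le_Rintegral => //; first exact: int_kfejer.
  by apply: intD; exact: intZ.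
move=> u _; have phi0 := fejer_ge0 A0 u.
have [ue|ue] := lerP `|u| eta; last first.
  apply: (@le_trans _ _ (C * (Keta eta A * (oneDsqr u)^-1))).
    by apply: ler_pM => //; rewrite fejer_off_center// ltW.
  by rewrite [leLHS]mulrA lerDr mulr_ge0// mulr_ge0// expR_ge0.
apply: (@le_trans _ _ (expR (al * (2 * eta)) * k n 0 * fejer A u)); last first.
  by rewrite lerDl mulr_ge0// mulr_ge0// Keta_ge0.
rewrite ler_wpM2r//.
move: ue; rewrite ler_norml => /andP[u1 u2].
have s0 : 0 <= u + eta by lra.
have := k_growth n 0 s0; rewrite add0r => /le_trans; apply.
rewrite ler_wpM2r// ler_expR ler_wpM2l//; lra.
Qed.

(** The frequency [A] is chosen so large that the mass of the Fejer kernel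
    outside the window is at most [eta] times its total mass. *)
Lemma k_squeeze (eta : R) : 0 < eta < 1 ->
  \forall n \near \oo,
    k n 0 * (1 - eta) <= expR (al * (2 * eta)) * (W^-1 + eta) /\
    W^-1 - eta - C * eta <= expR (al * (2 * eta)) * k n 0.
Proof.
move=> /andP[e0 e1]; have [c0 c00 c0P] := fejer_mass R.
pose b := 4 * ((1 + eta ^+ 2) / eta ^+ 2) * Pi.
have b0 : 0 <= b by rewrite !mulr_ge0// ?invr_ge0 ?addr_ge0 ?sqr_ge0.
pose A := b / (c0 * eta) + 1.
have A0 : 0 < A by rewrite ltr_wpDl// divr_ge0// mulr_ge0// ltW.
pose c := \int[leb]_u fejer A u.
have cc0 : c0 <= c by exact: c0P.
have cgt0 : 0 < c by exact: lt_le_trans cc0.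
have Kc : Keta eta A * Pi <= eta * c.
  have -> : Keta eta A * Pi = b / A by rewrite /Keta /b; ring.
  rewrite ler_pdivrMr//; apply: (@le_trans _ _ (eta * c0 * A)); last first.
    by rewrite ler_wpM2r ?(ltW A0)// ler_wpM2l// ltW.
  rewrite /A mulrDr mulr1 (_ : eta * c0 * (b / (c0 * eta)) = b); last first.
    by field; rewrite !gt_eqF.
  by rewrite lerDl mulr_ge0// ltW.
have cW : c / W + c * eta = c * (W^-1 + eta) by rewrite mulrDr.
near=> n; split.
- have := k_fejer_lower n A0 e0; rewrite -/c => lo.
  have I : \int[leb]_u (k n (u + - eta) * fejer A u) <= c * (W^-1 + eta).
    rewrite -cW; near: n.
    have /cvgrPdist_le := @k_fejer_cvg A (- eta) A0.
    move=> /(_ (c * eta)) []; first exact: mulr_gt0.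
    move=> N _ H; exists N => // m Nm; have := H m Nm.
    rewrite /= -/c ler_distl => /andP[]; lra.
  rewrite -(ler_pM2l cgt0); apply: (@le_trans _ _ (k n 0 * (c - Keta eta A * Pi))).
    rewrite mulrCA ler_wpM2l// mulrBr mulr1 lerB// (mulrC c)//.
  apply: (le_trans lo); rewrite [leRHS]mulrCA ler_wpM2l ?expR_ge0//.
- have := k_fejer_upper n A0 e0; rewrite -/c => up.
  have I : c * (W^-1 - eta) <= \int[leb]_u (k n (u + eta) * fejer A u).
    rewrite mulrBr; near: n.
    have /cvgrPdist_le := @k_fejer_cvg A eta A0.
    move=> /(_ (c * eta)) []; first exact: mulr_gt0.
    move=> N _ H; exists N => // m Nm; have := H m Nm.
    rewrite /= -/c ler_distl => /andP[]; lra.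
  rewrite -(ler_pM2l cgt0) mulrBr.
  rewrite lerBlDr; apply: (le_trans (le_trans I up)).
  rewrite (mulrC c (_ * k n 0)) lerD2l (_ : c * (C * eta) = C * (eta * c)).
    exact: ler_wpM2l.
  by ring.
Unshelve. all: by end_near. Qed.

Theorem kernel_sequence_cvg : k n 0 @[n --> \oo] --> W^-1.
Proof.
apply/cvgrPdist_le => e e0.
have U : (fun x : R => expR (al * (2 * x)) * (W^-1 + x) / (1 - x)) x @[x --> 0^'+] --> W^-1.
  rewrite [X in _ --> X](_ : _ = expR (al * (2 * 0)) * (W^-1 + 0) / (1 - 0)); last first.
    by rewrite !mulr0 expR0 subr0 addr0 mul1r divr1.
  apply: cvg_at_right_filter.
  apply: cvgM; last first.
    apply: cvgV; first by rewrite subr0.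
    by apply: cvgB; [exact: cvg_cst|exact: cvg_id].
  apply: cvgM.
    apply: (@continuous_comp _ _ _ (fun x : R => al * (2 * x)) expR 0); last exact: continuous_expR.
    by apply: cvgM; [exact: cvg_cst|apply: cvgM; [exact: cvg_cst|exact: cvg_id]].
  by apply: cvgD; [exact: cvg_cst|exact: cvg_id].
have L : (fun x : R => (W^-1 - x - C * x) / expR (al * (2 * x))) x @[x --> 0^'+] --> W^-1.
  rewrite [X in _ --> X](_ : _ = (W^-1 - 0 - C * 0) / expR (al * (2 * 0))); last first.
    by rewrite !mulr0 expR0 !subr0 divr1.
  apply: cvg_at_right_filter; apply: cvgM; last first.
    apply: cvgV; first by rewrite gt_eqF// expR_gt0.
    apply: (@continuous_comp _ _ _ (fun x : R => al * (2 * x)) expR 0); last exact: continuous_expR.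
    by apply: cvgM; [exact: cvg_cst|apply: cvgM; [exact: cvg_cst|exact: cvg_id]].
  apply: cvgB; first by apply: cvgB; [exact: cvg_cst|exact: cvg_id].
  by apply: cvgM; [exact: cvg_cst|exact: cvg_id].
move/cvgrPdist_le : U => /(_ e e0) U; move/cvgrPdist_le : L => /(_ e e0) L.
near (0 : R)^'+ => eta.
have e01 : 0 < eta < 1.
  apply/andP; split; near: eta; [exact: nbhs_right_gt|exact: nbhs_right_lt].
have /= Ue : `|W^-1 - expR (al * (2 * eta)) * (W^-1 + eta) / (1 - eta)| <= e.
  by near: eta.
have /= Le : `|W^-1 - (W^-1 - eta - C * eta) / expR (al * (2 * eta))| <= e.
  by near: eta.
have := k_squeeze e01; apply: filterS => n [].
case/andP: e01 => eta0 eta1.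
rewrite -ler_pdivlMr ?subr_gt0// => k1.
rewrite (mulrC _ (k n 0)) -ler_pdivrMr ?expR_gt0// => k2.
move: Ue Le; rewrite !ler_distl => /andP[Ue _] /andP[_ Le].
by apply/andP; split; lra.
Unshelve. all: by end_near. Qed.

End KernelSequence.

(** * Potter bounds and the Tauberian theorem for tails *)

(** Regular variation along unit steps bounds the ratio of consecutive values;
    iterating, and interpolating by monotonicity, gives exponential bounds that
    are uniform in the starting point. *)
Lemma potter (R : realType) (M : R -> R) (al dl X0 : R) : 0 < al -> 0 < dl ->
  (forall x y, X0 <= x -> x <= y -> M y <= M x) ->
  (\forall x \near +oo, 0 < M x) ->
  M (x + 1) / M x @[x --> +oo] --> expR (- al) ->
  \forall x \near +oo, 0 < M x /\ forall u, 0 <= u ->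
    expR (- (al + dl) * (u + 1)) * M x <= M (x + u) /\
    M (x + u) <= expR al * expR (- (al - dl) * u) * M x.
Proof.
move=> al0 dl0 monoM Mpos Mr.
have lo : \forall x \near +oo, expR (- (al + dl)) <= M (x + 1) / M x.
  by apply: (cvgr_ge _ Mr); rewrite ltr_expR; lra.
have hi : \forall x \near +oo, M (x + 1) / M x <= expR (- (al - dl)).
  by apply: (cvgr_le _ Mr); rewrite ltr_expR; lra.
have [x1 [_ x1P]] : \forall x \near +oo, [/\ X0 <= x, 0 < M x,
    expR (- (al + dl)) <= M (x + 1) / M x & M (x + 1) / M x <= expR (- (al - dl))].
  near=> x; split; near: x;
    [by apply: nbhs_pinfty_ge; exact: num_real|exact: Mpos|exact: lo|exact: hi].
have step n x : x1 < x -> expR (- (al + dl) * n%:R) * M x <= M (x + n%:R) /\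
   M (x + n%:R) <= expR (- (al - dl) * n%:R) * M x.
  move=> xx1; elim: n => [|n [IH1 IH2]]; first by rewrite !mulr0 expR0 addr0 mul1r.
  have xn : x1 < x + n%:R by rewrite ltr_wpDr.
  have [_ Mn0 l h] := x1P _ xn.
  rewrite ler_pdivlMr// in l; rewrite ler_pdivrMr// in h.
  rewrite -natr1 addrA !mulrDr !mulr1 !expRD; split.
  - apply: le_trans l; rewrite mulrAC mulrC; apply: ler_wpM2l; first exact: expR_ge0.
    exact: IH1.
  - apply: (le_trans h); rewrite [leRHS]mulrAC [leRHS]mulrC.
    by apply: ler_wpM2l; first exact: expR_ge0.
exists x1; split; first exact: num_real.
move=> x xx1; have [X0x Mx0 _ _] := x1P _ xx1; split=> // u u0.
have /andP[] := truncn_itv u0; set n := Num.trunc u => n1 n2.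
have [s1 _] := step n.+1 x xx1; have [_ s2] := step n x xx1.
have xn : x1 < x + n%:R by rewrite ltr_wpDr.
have [X0xn _ _ _] := x1P _ xn.
have X0xu : X0 <= x + u by apply: (le_trans X0x); rewrite lerDl.
split.
- apply: (@le_trans _ _ (M (x + n.+1%:R))); last first.
    by apply: monoM => //; rewrite lerD2l ltW.
  apply: le_trans s1; rewrite ler_wpM2r ?(ltW Mx0)// ler_expR.
  rewrite -natr1; nra.
- apply: (@le_trans _ _ (M (x + n%:R))).
    by apply: monoM => //; rewrite lerD2l.
  apply: (le_trans s2); rewrite -expRD ler_wpM2r ?(ltW Mx0)// ler_expR.
  move: n2; rewrite -natr1 => n2.
  have [ad|ad] := lerP al dl; first nra.
  nra.
Unshelve. all: by end_near. Qed.

Section Tauberian.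
Context d (T : measurableType d) (R : realType).
Variable mu : {sigma_finite_measure set T -> \bar R}.
Variables (om l : T -> R) (al dl : R).
Hypothesis om_ge0 : forall y, 0 <= om y.
Hypothesis mom : measurable_fun setT om.
Hypothesis ml : measurable_fun setT l.
Hypothesis al_gt0 : 0 < al.
Hypothesis dl_gt0 : 0 < dl.
Hypothesis iexp : mu.-integrable setT (EFin \o (fun y => om y * expR (dl * `|l y|))).
Hypothesis nonvanishing :
  forall x, cos_transform mu om l x ^+ 2 + sin_transform mu om l x ^+ 2 != 0.
Variables (N : R -> R) (B X0 : R).
Hypothesis N_ge0 : forall x, 0 <= N x.
Hypothesis NB : forall x, N x <= B.
Hypothesis N_noninc : forall x y, x <= y -> N y <= N x.

Local Notation wint := (weighted_int mu om l).
Let W : R := \int[mu]_y om y.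

(** In logarithmic coordinates this is the tail of the multiplicative
    convolution. *)
Definition tail_conv (x : R) : R := wint (fun v => expR (- (al * v)) * N (x - v)).
Local Notation M := tail_conv.

Hypothesis intM : forall x, X0 <= x ->
  mu.-integrable setT (EFin \o (fun y => om y * (expR (- (al * l y)) * N (x - l y)))).
Hypothesis M_gt0 : \forall x \near +oo, 0 < M x.
Hypothesis M_rv : forall t, M (x + t) / M x @[x --> +oo] --> expR (- (al * t)).

Let mN : measurable_fun setT N.
Proof. by apply: nonincreasing_measurable => // x y xy; exact: N_noninc. Qed.

Lemma sqr_le_expR y : 1 + l y ^+ 2 <= (1 + 2 / dl ^+ 2) * expR (dl * `|l y|).
Proof.
have z0 : 0 <= dl * `|l y| by rewrite mulr_ge0// ltW.
have := expR_ge1Dxn 1 z0; rewrite (_ : 2`! = 2%N)//.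
have -> : l y ^+ 2 = 2 / dl ^+ 2 * ((dl * `|l y|) ^+ 2 / 2).
  by rewrite exprMn (real_normK (num_real _)); field; rewrite gt_eqF//.
have : 0 <= 2 / dl ^+ 2 by rewrite divr_ge0// sqr_ge0.
have := sqr_ge0 (dl * `|l y|).
move: (2 / _) (_ ^+ 2) (expR _) => a b e b0 a0 h.
have := ler_wpM2l a0 h; nra.
Qed.

Lemma integrable_second_moment : mu.-integrable setT (EFin \o (fun y => om y * (1 + l y ^+ 2))).
Proof.
apply: (@integrable_dominated _ _ _ _ _ (fun y => (1 + 2 / dl ^+ 2) * (om y * expR (dl * `|l y|)))).
- by apply: measurable_funM => //; apply: measurable_funD => //; exact: measurable_funX.
- have := @integrableZl _ _ _ mu setT measurableT (1 + 2 / dl ^+ 2) _ iexp.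
  by apply: eq_integrable => // y _.
- move=> y; rewrite ger0_norm; last by rewrite mulr_ge0// addr_ge0// sqr_ge0.
  by rewrite mulrCA ler_wpM2l// sqr_le_expR.
Qed.

Let iom0 := integrable_om om_ge0 mom integrable_second_moment.

Lemma tail_conv_noninc x y : X0 <= x -> x <= y -> M y <= M x.
Proof.
move=> Xx xy; apply: le_Rintegral => //.
- by apply: intM; exact: le_trans xy.
- exact: intM.
- move=> z _; rewrite ler_wpM2l// ler_wpM2l ?expR_ge0//.
  by apply: N_noninc; rewrite lerD2r.
Qed.

(** The weight has positive mass on some [`|l y| <= m], and there
    [N (x - m - l y) >= N x] by monotonicity. *)
Lemma tail_le_tail_conv : exists m C0 : R, [/\ 0 <= m, 0 < C0 &
  forall x, X0 <= x - m -> N x <= C0 * M (x - m)].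
Proof.
have W0 : 0 < W := mass_gt0 om_ge0 nonvanishing.
pose ind n (y : T) : R := if `|l y| <= n%:R then 1 else 0.
have mind n : measurable_fun setT (ind n).
  apply: measurable_fun_ifT => //.
  by apply: measurable_fun_ler => //; exact: measurableT_comp.
have ind01 n y : 0 <= ind n y <= 1 by rewrite /ind; case: ifP; rewrite lexx ler01.
have : \int[mu]_y (om y * ind n y) @[n --> \oo] --> W.
  apply: (Rintegral_dominated_cvg _ _ iom0).
  - by move=> n; exact: measurable_funM.
  - move=> y; apply: cvg_near_cst.
    near=> n; rewrite /ind ifT ?mulr1//.
    near: n; exact: nbhs_infty_ger.
  - move=> n y; have /andP[i0 i1] := ind01 n y.
    by rewrite ger0_norm ?mulr_ge0// ler_piMr.
move=> /cvgr_gt => /(_ 0 W0) [n _ /(_ n (leqnn n))] /=.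
set ka := \int[mu]_y _ => ka0.
exists n%:R, (expR (al * n%:R) / ka); split => //.
  by rewrite divr_gt0// expR_gt0.
move=> x Xx.
have ik : mu.-integrable setT (EFin \o (fun y => om y * ind n y)).
  apply: (integrable_dominated _ iom0); first exact: measurable_funM.
  move=> y; have /andP[i0 i1] := ind01 n y.
  by rewrite ger0_norm ?mulr_ge0// ler_piMr.
have key : expR (- (al * n%:R)) * N x * ka <= M (x - n%:R).
  rewrite /ka -RintegralZl//; apply: le_Rintegral => //.
  - have := @integrableZl _ _ _ mu setT measurableT (expR (- (al * n%:R)) * N x) _ ik.
    by apply: eq_integrable => // y _.
  - exact: intM.
  move=> y _; rewrite mulrCA ler_wpM2l// /ind; case: ifPn => [ln|_]; last first.
    by rewrite mulr0 mulr_ge0 ?expR_ge0.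
  rewrite mulr1; move: ln; rewrite ler_norml => /andP[l1 l2].
  apply: ler_pM; [exact: expR_ge0|exact: N_ge0| |].
    by rewrite ler_expR lerN2 ler_wpM2l// ltW.
  by apply: N_noninc; lra.
rewrite -(ler_pM2r ka0) mulrAC divfK ?gt_eqF//.
rewrite -(ler_pM2l (expR_gt0 (- (al * n%:R)))) mulrA (le_trans key)//.
by rewrite mulrA -expRD addNr expR0 mul1r.
Unshelve. all: by end_near. Qed.

(** Its convolution with the weight at [t] is
    [expR (al * t) * M (x + t) / M x], which tends to one. *)
Definition scaled_tail (x u : R) : R := expR (al * u) * N (x + u) / M x.

(** For [x + u] large, [N (x + u)] is controlled by [M] and Potter's bounds
    apply on either side of [x]; otherwise [N] is at most [B] and the lower
    Potter bound for [M x] suffices. *)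
Lemma scaled_tail_bound : exists Cd : R, \forall x \near +oo,
  0 < M x /\ forall u, scaled_tail x u <= Cd * expR (dl * `|u|).
Proof.
have [m [C0 [m0 C00 NM]]] := tail_le_tail_conv.
have M1 := @M_rv 1; rewrite mulr1 in M1.
have pot := potter al_gt0 dl_gt0 tail_conv_noninc M_gt0 M1.
have [x1 [_ x1P']] : \forall x \near +oo, X0 <= x /\ (0 < M x /\ forall u, 0 <= u ->
    expR (- (al + dl) * (u + 1)) * M x <= M (x + u) /\
    M (x + u) <= expR al * expR (- (al - dl) * u) * M x).
  near=> x; split; near: x; last exact: pot.
  by apply: nbhs_pinfty_ge; exact: num_real.
pose x2 := x1 + 1.
have x12 : x1 < x2 by rewrite ltrDl.
have x2P x : x2 <= x -> X0 <= x /\ (0 < M x /\ forall u, 0 <= u ->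
    expR (- (al + dl) * (u + 1)) * M x <= M (x + u) /\
    M (x + u) <= expR al * expR (- (al - dl) * u) * M x).
  by move=> x2x; apply: x1P'; exact: lt_le_trans x2x.
have [X0x2 [Mx20 _]] := x2P _ (lexx x2).
pose E := expR ((al + dl) * (m + 1)).
exists ((C0 * expR al + C0 + B / M x2) * E).
have B0 : 0 <= B by exact: le_trans (N_ge0 0) (NB 0).
near=> x.
have xm : x2 <= x - m.
  by rewrite lerBrDr; near: x; apply: nbhs_pinfty_ge; exact: num_real.
have x2x : x2 <= x by lra.
have [X0x [Mx0 px]] := x2P _ x2x; split=> // u.
have [X0xm [Mxm0 pxm]] := x2P _ xm.
rewrite /scaled_tail ler_pdivrMr//.
have E0 : 0 < E := expR_gt0 _.
have B2 : 0 <= B / M x2 by rewrite divr_ge0// ltW.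
have CB : 0 <= C0 + B / M x2 by rewrite addr_ge0// ltW.
have [u0|u0] := lerP 0 u.
- (* upper Potter bound from x - m, then the lower one back to x *)
  have NC : N (x + u) <= C0 * M (x - m + u).
    by rewrite addrAC; apply: NM; rewrite addrAC; apply: (le_trans X0xm); rewrite lerDl.
  have [_ up] := pxm u u0.
  have [lo _] := pxm m m0; rewrite subrK in lo.
  have lo' : M (x - m) <= E * M x.
    by rewrite -(ler_pM2l (expR_gt0 (- (al + dl) * (m + 1)))) (le_trans lo)// mulrA -expRD mulNr addNr expR0 mul1r.
  rewrite (ger0_norm u0).
  apply: (@le_trans _ _ (expR (al * u) * (C0 * (expR al * expR (- (al - dl) * u) * (E * M x))))).
    rewrite ler_wpM2l ?expR_ge0//; apply: (le_trans NC); rewrite ler_wpM2l ?(ltW C00)//.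
    by apply: (le_trans up); rewrite ler_wpM2l// mulr_ge0 ?expR_ge0.
  have -> : expR (dl * u) = expR (al * u) * expR (- (al - dl) * u).
    by rewrite -expRD; congr expR; ring.
  have := expR_ge0 (al * u); have := expR_ge0 (- (al - dl) * u); have := expR_ge0 al.
  move: (expR al) (expR (al * u)) (expR (- (al - dl) * u)) => p q r p0 r0 q0.
  rewrite [leRHS](_ : _ = q * (C0 * (p * r * (E * M x))) + (C0 + B / M x2) * (E * (q * r) * M x)); last by ring.
  by rewrite lerDl; do ?[apply: mulr_ge0 => //]; try exact: ltW.
- have un : `|u| = - u by rewrite ltr0_norm.
  have EE : expR (- (al + dl) * (m - u + 1)) * (E * expR (- (al + dl) * u)) = 1.
    by rewrite /E -!expRD -[RHS]expR0; congr expR; ring.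
  have e1 : expR (dl * `|u|) = expR (al * u) * expR (- (al + dl) * u).
    by rewrite un -expRD; congr expR; ring.
  have mu0 : 0 <= m - u by lra.
  suff NE : N (x + u) <= (C0 + B / M x2) * E * expR (- (al + dl) * u) * M x.
    rewrite e1; apply: (@le_trans _ _ (expR (al * u) * ((C0 + B / M x2) * E * expR (- (al + dl) * u) * M x))).
      by rewrite ler_wpM2l ?expR_ge0.
    have := expR_ge0 (al * u); have := expR_ge0 (- (al + dl) * u); have := expR_ge0 al.
    move: (expR al) (expR (al * u)) (expR (- (al + dl) * u)) => p q r p0 r0 q0.
    rewrite [leRHS](_ : _ = q * ((C0 + B / M x2) * E * r * M x) + (C0 * p) * (E * (q * r) * M x)); last by ring.
    by rewrite lerDl; do ?[apply: mulr_ge0 => //]; try exact: ltW.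
  have [v|v] := lerP x2 (x + u - m).
  + have [X0v [Mv0 pv]] := x2P _ v.
    have NC : N (x + u) <= C0 * M (x + u - m) by exact: NM.
    have [lo _] := pv _ mu0; rewrite (_ : x + u - m + (m - u) = x) in lo; last by ring.
    have lo' : M (x + u - m) <= E * expR (- (al + dl) * u) * M x.
      rewrite -(ler_pM2l (expR_gt0 (- (al + dl) * (m - u + 1)))) (le_trans lo)//.
      by rewrite [leRHS]mulrA EE mul1r.
    apply: (le_trans NC); apply: (@le_trans _ _ (C0 * (E * expR (- (al + dl) * u) * M x))).
      by rewrite ler_wpM2l// ltW.
    rewrite !mulrA !ler_wpM2r ?expR_ge0 ?(ltW E0) ?(ltW Mx0)//.
    by rewrite lerDl.
  + have dx : 0 <= x - x2 by rewrite subr_ge0.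
    have [lo _] := (x2P _ (lexx x2)).2.2 _ dx; rewrite subrKC in lo.
    have lo' : M x2 <= E * expR (- (al + dl) * u) * M x.
      rewrite -(ler_pM2l (expR_gt0 (- (al + dl) * (m - u + 1)))).
      rewrite [leRHS]mulrA EE mul1r; apply: le_trans lo.
      rewrite ler_wpM2r ?(ltW Mx20)// ler_expR.
      have := al_gt0; have := dl_gt0; nra.
    apply: (le_trans (NB _)).
    apply: (@le_trans _ _ (B / M x2 * (E * expR (- (al + dl) * u) * M x))).
      by rewrite -mulrA ler_peMr// ler_pdivlMl// mulr1.
    rewrite !mulrA !ler_wpM2r ?expR_ge0 ?(ltW E0) ?(ltW Mx0)//.
    by rewrite lerDr ltW.
Unshelve. all: by end_near. Qed.

(** The hypotheses of [kernel_sequence_cvg] hold for the scaled tails truncated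
    at a constant [C]: truncation preserves the growth condition, and the error
    it makes in the convolution vanishes because at each point it is eventually
    inactive. *)
Theorem tauberian_tail_ratio : N x / M x @[x --> +oo] --> W^-1.
Proof.
apply/cvg_pinftyP => u uy.
have [Cd [x0 [_ x0P]]] := scaled_tail_bound.
have [m [C0 [m0 C00 NM]]] := tail_le_tail_conv.
(* Raising the first terms keeps the whole sequence in the range of the bounds. *)
pose xs n := Num.max (u n) (x0 + 1).
have xs0 n : x0 < xs n by rewrite lt_max ltrDl ltr01 orbT.
have Mxs n : 0 < M (xs n) by case: (x0P _ (xs0 n)).
have bound n v : scaled_tail (xs n) v <= Cd * expR (dl * `|v|).
  by case: (x0P _ (xs0 n)).
have st0 n v : 0 <= scaled_tail (xs n) v.
  by rewrite /scaled_tail divr_ge0 ?(ltW (Mxs n))// mulr_ge0 ?expR_ge0.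
have xsy (P : R -> Prop) : (\forall x \near +oo, P x) -> \forall n \near \oo, P (xs n).
  move=> [z [_ zP]]; near=> n; apply: zP; rewrite lt_max; apply/orP; left.
  near: n; apply: (cvgry_gt uy).
(* C0 * expR (al * m) bounds the upper limit of the scaled tails at every point. *)
pose C := C0 * expR (al * m) + 1.
have capped v : \forall n \near \oo, scaled_tail (xs n) v <= C.
  apply: (xsy (fun x => scaled_tail x v <= C)).
  have := @M_rv (v - m) => Mr.
  have {}Mr : expR (al * v) * (C0 * (M (x + (v - m)) / M x)) @[x --> +oo] -->
      expR (al * v) * (C0 * expR (- (al * (v - m)))).
    by apply: cvgM; [exact: cvg_cst|apply: cvgM; [exact: cvg_cst|exact: Mr]].
  have lim : expR (al * v) * (C0 * expR (- (al * (v - m)))) < C.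
    rewrite mulrCA -expRD (_ : al * v + _ = al * m); last by ring.
    by rewrite /C ltrDl.
  have le := cvgr_le _ Mr _ lim.
  near=> x.
  have Mx : 0 < M x by near: x; exact: M_gt0.
  apply: (@le_trans _ _ (expR (al * v) * (C0 * (M (x + (v - m)) / M x)))); last first.
    by near: x; exact: le.
  rewrite /scaled_tail -mulrA ler_wpM2l ?expR_ge0// mulrA ler_wpM2r ?invr_ge0 ?(ltW Mx)//.
  rewrite addrA; apply: NM; rewrite -addrA -lerBlDr.
  near: x; apply: nbhs_pinfty_ge; exact: num_real.
pose k n v := Num.min C (scaled_tail (xs n) v).
have C_ge0 : 0 <= C by rewrite addr_ge0// mulr_ge0 ?expR_ge0 ?(ltW C00).
have mst n : measurable_fun setT (scaled_tail (xs n)).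
  apply: measurable_funM => //; apply: measurable_funM.
    apply: (measurableT_comp (continuous_measurable_fun (@continuous_expR R))).
    exact: measurable_funM.
  by apply: (measurableT_comp mN); exact: measurable_funD.
have mk n : measurable_fun setT (k n) by apply: measurable_minr.
have k0 n v : 0 <= k n v by rewrite le_min C_ge0 st0.
have kC n v : k n v <= C by rewrite ge_min lexx.
have kgrow n (v s : R) : 0 <= s -> k n (v + s) <= expR (al * s) * k n v.
  move=> s0; have e1 : 1 <= expR (al * s) by rewrite -expR0 ler_expR mulr_ge0// ltW.
  rewrite /k minr_pMr ?expR_ge0// le_min !ge_min; apply/andP; split.
    by rewrite ler_peMl.
  apply/orP; right; rewrite /scaled_tail !mulrA -expRD -mulrDr (addrC s).
  rewrite ler_wpM2r ?invr_ge0 ?(ltW (Mxs n))// ler_wpM2l ?expR_ge0//.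
  by apply: N_noninc; rewrite addrA lerDl.
have iE (t : R) : mu.-integrable setT
    (EFin \o (fun y => (Cd * expR (dl * `|t|)) * (om y * expR (dl * `|l y|)))).
  have := @integrableZl _ _ _ mu setT measurableT (Cd * expR (dl * `|t|)) _ iexp.
  by apply: eq_integrable => // y _.
have Cd0 : 0 <= Cd.
  have := le_trans (st0 0%N 0) (bound 0%N 0).
  by rewrite normr0 mulr0 expR0 mulr1.
have dom n t y : om y * scaled_tail (xs n) (t - l y) <=
    (Cd * expR (dl * `|t|)) * (om y * expR (dl * `|l y|)).
  rewrite [leRHS]mulrCA ler_wpM2l//; apply: (le_trans (bound _ _)).
  rewrite -mulrA ler_wpM2l// -expRD ler_expR -mulrDr ler_wpM2l ?(ltW dl_gt0)//.
  exact: ler_normB.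
have mst' n t : measurable_fun setT (fun y => om y * scaled_tail (xs n) (t - l y)).
  apply: measurable_funM => //; apply: (measurableT_comp (mst n)).
  exact: measurable_funB.
have mk' n t : measurable_fun setT (fun y => om y * k n (t - l y)).
  apply: measurable_funM => //; apply: (measurableT_comp (mk n)).
  exact: measurable_funB.
have ist n t : mu.-integrable setT (EFin \o (fun y => om y * scaled_tail (xs n) (t - l y))).
  apply: (integrable_dominated _ (iE t)) => // y.
  by rewrite ger0_norm; [exact: dom|apply: mulr_ge0].
have ik n t : mu.-integrable setT (EFin \o (fun y => om y * k n (t - l y))).
  apply: (integrable_dominated _ (iE t)) => // y.
  rewrite ger0_norm ?mulr_ge0//; apply: le_trans (dom n t y).
  by rewrite ler_wpM2l// ge_min lexx orbT.
have kcvg t : wint (fun v => k n (t - v)) @[n --> \oo] --> (1 : R).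
  have st_cvg : \int[mu]_y (om y * scaled_tail (xs n) (t - l y)) @[n --> \oo] --> (1 : R).
    have -> : (fun n => \int[mu]_y (om y * scaled_tail (xs n) (t - l y))) =
        (fun n => expR (al * t) * (M (xs n + t) / M (xs n))).
      apply/funext => n; rewrite [M (xs n + t)]/tail_conv /weighted_int.
      rewrite [X in _ = _ * (X / _)](@eq_Rintegral _ _ _ mu setT (fun y => (M (xs n) * expR (- (al * t))) *
           (om y * scaled_tail (xs n) (t - l y)))); last first.
        move=> y _; rewrite /= /scaled_tail addrA (_ : expR (- (al * l y)) =
            expR (- (al * t)) * expR (al * (t - l y))); last first.
          by rewrite -expRD; congr expR; ring.
        by field; rewrite gt_eqF.
      rewrite RintegralZl// expRN; field.
      by rewrite !gt_eqF// expR_gt0.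
    rewrite [X in _ --> X](_ : _ = expR (al * t) * expR (- (al * t))); last first.
      by rewrite -expRD addrN expR0.
    apply: cvgM; first exact: cvg_cst.
    have := @M_rv t => Mr.
    apply: (cvg_comp _ _ _ Mr).
    by move=> P /= /xsy.
  have D_cvg : \int[mu]_y (om y * scaled_tail (xs n) (t - l y) - om y * k n (t - l y))
      @[n --> \oo] --> (0 : R).
    rewrite [X in _ --> X](_ : _ = \int[mu]_y cst (0 : R) y); last first.
      by rewrite Rintegral_cst// mul0r.
    apply: (Rintegral_dominated_cvg _ _ (iE t)).
    - by move=> n; apply: measurable_funB.
    - move=> y; apply: cvg_near_cst; have := capped (t - l y); apply: filterS => n h.
      by rewrite /k /cst min_r// subrr.
    - move=> n y; rewrite -mulrBr ger0_norm; last first.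
        by rewrite mulr_ge0// subr_ge0 ge_min lexx orbT.
      apply: le_trans (dom n t y); rewrite ler_wpM2l// gerBl//.
  have -> : (fun n => wint (fun v => k n (t - v))) =
    (fun n => \int[mu]_y (om y * scaled_tail (xs n) (t - l y)) -
      \int[mu]_y (om y * scaled_tail (xs n) (t - l y) - om y * k n (t - l y))).
    by apply/funext => n; rewrite RintegralB// opprB addrC subrK.
  by rewrite -[X in _ --> X]subr0; apply: cvgB.
have := kernel_sequence_cvg om_ge0 mom ml integrable_second_moment nonvanishing (ltW al_gt0) mk k0 kC kgrow kcvg.
apply: cvg_trans; apply: near_eq_cvg.
have uX : \forall n \near \oo, x0 + 1 <= u n by apply: (cvgry_ge uy).
near=> n.
have un : xs n = u n by rewrite /xs max_l//; near: n.
have c0 : scaled_tail (xs n) 0 <= C by near: n; exact: capped.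
by rewrite /k min_r// /scaled_tail mulr0 expR0 mul1r addr0 un.
Unshelve. all: by end_near. Qed.

End Tauberian.

(** * Regularly varying tails *)
Section RegularVariation.
Variable R : realType.
Implicit Types (m : set (measurableTypeR R) -> \bar R) (al : R).

(** The real-valued tail; it is meaningful only where the tail is finite. *)
Definition rtail m (x : R) : R := fine (m `]x, +oo[%classic).

Lemma near_pinfty_scale (c : R) (P : R -> Prop) : 0 < c ->
  (\forall x \near +oo, P x) -> \forall x \near +oo, P (c * x).
Proof.
move=> c0 [z [_ zP]]; exists (z / c); split; first exact: num_real.
by move=> x /=; rewrite ltr_pdivrMr// mulrC; exact: zP.
Qed.

Lemma near_pinfty_gt0 : \forall x \near +oo, (0 : R) < x.
Proof. by apply: nbhs_pinfty_gt; exact: num_real. Qed.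

Lemma powR_mulN (c al : R) : 0 < c -> c `^ al * c `^ (- al) = 1.
Proof. by move=> c0; rewrite powRN divff// gt_eqF// powR_gt0. Qed.

(** The slowly varying factor can be eliminated: it is the tail times a power. *)
Lemma rv_tail_expP m al : rv_tail_exp al m <->
  [/\ 0 <= al,
      \forall x \near +oo, m `]x, +oo[%classic = (rtail m x)%:E /\ 0 < rtail m x &
      forall c : R, 0 < c -> rtail m (c * x) / rtail m x @[x --> +oo] --> c `^ (- al)].
Proof.
split.
- move=> [al0 _ [L [Lpos Lsv] mL]].
  have rtE : \forall x \near +oo, rtail m x = x `^ (- al) * L x.
    by apply: filterS mL => x mx; rewrite /rtail mx.
  split => //.
  + near=> x.
    have Lx : 0 < L x by near: x; exact: Lpos.
    have x0 : 0 < x by near: x; exact: near_pinfty_gt0.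
    have mx : m `]x, +oo[%classic = (x `^ (- al) * L x)%:E by near: x; exact: mL.
    by rewrite /rtail mx /=; split=> //; rewrite mulr_gt0// powR_gt0.
  + move=> c c0; have Lc := Lsv c c0.
    have H : c `^ (- al) * (L (c * x) / L x) @[x --> +oo] --> c `^ (- al).
      by rewrite -[X in _ --> X]mulr1; apply: cvgM; [exact: cvg_cst|exact: Lc].
    apply: cvg_trans H; apply: near_eq_cvg; near=> x.
    have x0 : 0 < x by near: x; exact: near_pinfty_gt0.
    have -> : rtail m x = x `^ (- al) * L x by near: x; exact: rtE.
    have -> : rtail m (c * x) = (c * x) `^ (- al) * L (c * x).
      by near: x; exact: (near_pinfty_scale c0 rtE).
    have Lx : 0 < L x by near: x; exact: Lpos.
    rewrite powRM ?ltW//; field.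
    by rewrite !gt_eqF ?powR_gt0.
- move=> [al0 mfin mr]; split => //.
  + near (pinfty_nbhs R) => a; exists a; first by near: a; exact: near_pinfty_gt0.
    have [-> _] : m `]a, +oo[%classic = (rtail m a)%:E /\ 0 < rtail m a.
      by near: a.
    exact: ltry.
  + exists (fun x => x `^ al * rtail m x).
    * split.
        near=> x.
        have x0 : 0 < x by near: x; exact: near_pinfty_gt0.
        have [_ mx] : m `]x, +oo[%classic = (rtail m x)%:E /\ 0 < rtail m x by near: x.
        by rewrite mulr_gt0// powR_gt0.
      move=> c c0.
      have H : c `^ al * (rtail m (c * x) / rtail m x) @[x --> +oo] --> (1 : R).
        rewrite [X in _ --> X](_ : _ = c `^ al * c `^ (- al)); last first.
          by rewrite powR_mulN.
        by apply: cvgM; [exact: cvg_cst|exact: mr].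
      apply: cvg_trans H; apply: near_eq_cvg; near=> x.
      have x0 : 0 < x by near: x; exact: near_pinfty_gt0.
      have [_ mx] : m `]x, +oo[%classic = (rtail m x)%:E /\ 0 < rtail m x by near: x.
      rewrite powRM ?ltW//; field.
      by rewrite !gt_eqF ?powR_gt0.
    * near=> x.
      have x0 : 0 < x by near: x; exact: near_pinfty_gt0.
      have [-> _] : m `]x, +oo[%classic = (rtail m x)%:E /\ 0 < rtail m x by near: x.
      by rewrite mulrCA mulrA powR_mulN// mul1r.
Unshelve. all: by end_near. Qed.

End RegularVariation.

(** * The tail of a multiplicative convolution *)
Section ConvolutionTail.
Variable R : realType.
Variables nu rho : {sigma_finite_measure set (measurableTypeR R) -> \bar R}.
Local Notation tl x := (`]x%R, +oo[%classic : set (measurableTypeR R)).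

(** [small_part] and [large_part] are the contributions to the tail at [X] of
    the mass of [nu] in [`]0, b]] and beyond [b].  The former is written as in
    the negligibility condition, the latter with [rho] outside, as in the
    convolution. *)
Definition small_part (b X : R) : \bar R :=
  (\int[nu]_(y in `]0%R, b]%classic) rho `](X / (y : R))%R, +oo[%classic)%E.

Lemma mconv_tail X : mconv nu rho (tl X) =
  (\int[rho]_(y in tl 0) nu (tl (X / y)))%E.
Proof.
apply: eq_integral => y /set_mem/=; rewrite in_itv/= andbT => y0.
congr (nu _); apply/seteqP; split => x /=.
  move=> [z /=]; rewrite !in_itv/= !andbT => Xz <-.
  by rewrite mulrC ltr_pM2l ?invr_gt0.
rewrite in_itv/= andbT => Xyx; exists (y * x).
  by rewrite /= in_itv/= andbT mulrC -ltr_pdivrMr.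
by rewrite mulKf// gt_eqF.
Qed.

Let section_set (X : R) (C : set (measurableTypeR R)) :
  set (measurableTypeR R * measurableTypeR R) :=
  [set p | X < p.1 * p.2 /\ C p.2].

Let measurable_section X C : measurable C -> measurable (section_set X C).
Proof.
move=> mC.
pose mulf (p : measurableTypeR R * measurableTypeR R) : measurableTypeR R := p.1 * p.2.
have -> : section_set X C = (mulf @^-1` `]X, +oo[) `&` (snd @^-1` C).
  by apply/seteqP; split => p /=; rewrite in_itv/= andbT.
have mf : measurable_fun setT mulf.
  by apply: measurable_funM; [exact: measurable_fst|exact: measurable_snd].
apply: measurableI; rewrite -[X in measurable X]setTI.
  by apply: mf => //; exact: measurable_itv.
exact: measurable_snd.
Qed.

Let xsectionE X C (y : R) : 0 < y -> xsection (section_set X C) y = tl (X / y) `&` C.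
Proof.
move=> y0; apply/seteqP; split => z; rewrite /xsection/=.
  move/set_mem => [/= h Cz]; split => //=; rewrite in_itv/= andbT.
  by rewrite ltr_pdivrMr// mulrC.
rewrite in_itv/= andbT => -[h Cz]; apply/mem_set; split => //=.
by rewrite mulrC -ltr_pdivrMr.
Qed.

Lemma measurable_conv_section X C : measurable C ->
  measurable_fun (tl 0) (fun y => nu (tl (X / y) `&` C)).
Proof.
move=> mC.
have h : measurable_fun (tl 0) (nu \o xsection (section_set X C)).
  apply: measurable_funTS; apply: measurable_fun_xsection; exact: measurable_section.
apply: eq_measurable_fun h => y /set_mem/=; rewrite in_itv/= andbT => y0.
by rewrite xsectionE.
Qed.

(** Tonelli on the set of pairs with [X < z * y] and [y] in [`]0, b]]. *)
Lemma small_partE b X : 0 < X ->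
  small_part b X = (\int[rho]_(y in tl 0) nu (tl (X / y) `&` `]0%R, b]))%E.
Proof.
move=> X0; set C := `]0%R, b]%classic : set (measurableTypeR R).
have mA := measurable_section X (measurable_itv _ : measurable C).
have := @indic_fubini_tonelli _ _ _ _ R rho nu _ mA.
rewrite /= indic_fubini_tonelli_FE// indic_fubini_tonelli_GE// => E.
rewrite /small_part [RHS]integral_mkcond.
transitivity (\int[nu]_y (rho \o ysection (section_set X C)) y)%E.
  rewrite integral_mkcond; apply: eq_integral => y _; rewrite patchE /=.
  case: ifPn => yC.
    congr (rho _); apply/seteqP; split => z; rewrite /ysection/=.
      rewrite in_itv/= andbT => h; apply/mem_set; split => /=; last exact/set_mem.
      rewrite -ltr_pdivrMr//; by move/set_mem: yC; rewrite /C/= in_itv/= => /andP[].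
    move/set_mem => [/= h _]; rewrite in_itv/= andbT ltr_pdivrMr//.
    by move/set_mem: yC; rewrite /C/= in_itv/= => /andP[].
  rewrite (_ : ysection _ _ = set0) ?measure0//.
  apply/seteqP; split => z //; rewrite /ysection/= => /set_mem [/= _ Cy].
  by move/negP: yC; apply; apply/mem_set.
rewrite -E; apply: eq_integral => y _; rewrite patchE /=.
case: ifPn => y0.
  by rewrite xsectionE//; move/set_mem: y0; rewrite /= in_itv/= andbT.
rewrite (_ : xsection _ _ = set0) ?measure0//.
apply/seteqP; split => z //; rewrite /xsection/= => /set_mem [/= h Cz].
move/negP: y0; apply; apply/mem_set; rewrite /= in_itv/= andbT.
move: Cz; rewrite /C/= in_itv/= => /andP[z0 _].
by have := lt_trans X0 h; rewrite pmulr_lgt0.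
Qed.

Definition large_part (b X : R) : \bar R :=
  (\int[rho]_(y in tl 0) nu (tl (X / y) `&` tl b))%E.

Lemma mconv_split b X : 0 < X -> 0 < b ->
  mconv nu rho (tl X) = (small_part b X + large_part b X)%E.
Proof.
move=> X0 b0; rewrite mconv_tail small_partE// /large_part -ge0_integralD//.
- apply: eq_integral => y /set_mem/=; rewrite in_itv/= andbT => y0.
  rewrite -measureU.
  + congr (nu _); rewrite -setIUr.
    apply/seteqP; split => z /=; last by case.
    rewrite !in_itv/= !andbT => h; split => //.
    have z0 : 0 < z by apply: lt_trans h; rewrite divr_gt0.
    by rewrite z0/=; case: (lerP z b); [left|right].
  + by apply: measurableI; exact: measurable_itv.
  + by apply: measurableI; exact: measurable_itv.
  + apply/seteqP; split => z //= -[[_ +] [_]].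
    by rewrite !in_itv/= andbT => /andP[_ zb] /lt_geF; rewrite zb.
- by apply: measurable_conv_section; exact: measurable_itv.
- by apply: measurable_conv_section; exact: measurable_itv.
Qed.

Lemma mconv_noninc X Y : X <= Y -> (mconv nu rho (tl Y) <= mconv nu rho (tl X))%E.
Proof.
move=> XY; rewrite !mconv_tail; apply: ge0_le_integral => //.
- have := @measurable_conv_section Y setT measurableT.
  by apply: eq_measurable_fun => y _; rewrite setIT.
- have := @measurable_conv_section X setT measurableT.
  by apply: eq_measurable_fun => y _; rewrite setIT.
- move=> y /=; rewrite in_itv/= andbT => y0.
  apply: le_measure; rewrite ?inE; [exact: measurable_itv|exact: measurable_itv|].
  apply: subset_itvr; rewrite bnd_simp.
  by rewrite ler_pM2r// invr_gt0.
Qed.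

(** For [y > a] the integrand [nu (tl (a * X / y))] is at least [nu (tl X)]. *)
Lemma tail_le_mconv a X : 0 < a -> 0 <= X ->
  (nu (tl X) * rho (tl a) <= mconv nu rho (tl (a * X)))%E.
Proof.
move=> a0 X0; rewrite mconv_tail.
apply: (@le_trans _ _ (\int[rho]_(y in tl a) nu (tl X))%E).
  by rewrite integral_cst//; exact: measurable_itv.
have sub : tl a `<=` tl 0.
  by apply: subset_itvr; rewrite bnd_simp ltW.
have mf : measurable_fun (tl 0) (fun y => nu (tl (a * X / y))).
  have := @measurable_conv_section (a * X) setT measurableT.
  by apply: eq_measurable_fun => y _; rewrite setIT.
apply: (@le_trans _ _ (\int[rho]_(y in tl a) nu (tl (a * X / y)))%E).
  apply: ge0_le_integral => //.
  - by apply: measurable_funS mf => //; exact: measurable_itv.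
  - move=> y /=; rewrite in_itv/= andbT => ay.
    apply: le_measure; rewrite ?inE; [exact: measurable_itv|exact: measurable_itv|].
    apply: subset_itvr; rewrite bnd_simp.
    rewrite ler_pdivrMr; last exact: lt_trans ay.
    by rewrite mulrC ler_wpM2l// ltW.
exact: ge0_subset_integral.
Qed.

End ConvolutionTail.

(** * The weight attached to rho *)
Section Moments.
Variable R : realType.
Variable rho : {sigma_finite_measure set (measurableTypeR R) -> \bar R}.
Variables (al dl : R).
Hypothesis al_gt0 : 0 < al.
Hypothesis dl_gt0 : 0 < dl.
Hypothesis rho_pos : on_positives rho.
Hypothesis rho_neq0 : rho setT != 0%E.
Hypothesis moment : (\int[rho]_(y in `]0%R, +oo[%classic)
  (Num.max ((y : R) `^ (al - dl)) ((y : R) `^ (al + dl)))%:E < +oo)%E.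
Local Notation tl x := (`]x%R, +oo[%classic : set (measurableTypeR R)).

Lemma powR_expR (y r : R) : 0 < y -> y `^ r = expR (r * ln y).
Proof. by move=> y0; rewrite /powR gt_eqF. Qed.

Let mmax : measurable_fun (tl 0)
  (fun y : measurableTypeR R => (Num.max ((y : R) `^ (al - dl)) ((y : R) `^ (al + dl)))).
Proof.
by apply: measurable_maxr; apply: measurable_funTS; exact: measurable_powR.
Qed.

(** Markov's inequality for the moment of order [al + dl]. *)
Lemma rho_tail_le Z : 0 < Z -> rho (tl Z) =  (rtail rho Z)%:E /\
  rtail rho Z * Z `^ (al + dl) <= fine (\int[rho]_(y in tl 0)
     (Num.max ((y : R) `^ (al - dl)) ((y : R) `^ (al + dl)))%:E)%E.
Proof.
move=> Z0; set K := (\int[rho]_(y in tl 0) _)%E.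
have K0 : (0 <= K)%E.
  by apply: integral_ge0 => y _; rewrite lee_fin le_max powR_ge0.
have Kfin : K \is a fin_num by rewrite ge0_fin_numE.
have ZK : (rho (tl Z) * (Z `^ (al + dl))%:E <= K)%E.
  rewrite muleC -integral_cst; last exact: measurable_itv.
  have sub : tl Z `<=` tl 0 by apply: subset_itvr; rewrite bnd_simp ltW.
  have mmaxE : measurable_fun (tl 0)
    (fun y : measurableTypeR R => (Num.max ((y : R) `^ (al - dl)) ((y : R) `^ (al + dl)))%:E).
    by apply/measurable_EFinP.
  apply: (@le_trans _ _ (\int[rho]_(y in tl Z)
     (Num.max ((y : R) `^ (al - dl)) ((y : R) `^ (al + dl)))%:E)%E).
    apply: ge0_le_integral => //.
    - by move=> y _; rewrite lee_fin powR_ge0.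
    - exact: measurable_funS mmaxE.
    - move=> y /=; rewrite in_itv/= andbT => Zy; rewrite lee_fin le_max; apply/orP; right.
      by rewrite ge0_ler_powR ?nnegrE ?addr_ge0 ?ltW// (lt_trans Z0).
  by apply: ge0_subset_integral => // y _; rewrite lee_fin le_max powR_ge0.
have Zp : 0 < Z `^ (al + dl) by exact: powR_gt0.
have fin : rho (tl Z) \is a fin_num.
  rewrite ge0_fin_numE//; rewrite -(fineK Kfin) in ZK.
  case: (rho (tl Z)) ZK => [r| |] //=; first by rewrite ltry.
  by rewrite gt0_mulye// leye_eq.
have E : rho (tl Z) = (rtail rho Z)%:E by rewrite /rtail fineK.
by split => //; rewrite -lee_fin (fineK Kfin) EFinM -E.
Qed.

Definition weight : measurableTypeR R -> R := (fun y : R => y `^ al) \_ (tl 0).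

Lemma weight_ge0 y : 0 <= weight y.
Proof. by rewrite /weight patchE; case: ifP => // _; exact: powR_ge0. Qed.

Lemma measurable_weight : measurable_fun setT weight.
Proof.
apply/measurable_restrict => //.
by rewrite setTI; apply: measurable_funTS; exact: measurable_powR.
Qed.

Lemma weightE y : 0 < y -> weight y = expR (al * ln y).
Proof.
by move=> y0; rewrite /weight patchE ifT ?powR_expR//; apply/mem_set; rewrite /= in_itv/= y0.
Qed.

Lemma weight0 y : y <= 0 -> weight y = 0.
Proof.
move=> y0; rewrite /weight patchE ifF//; apply/negP => /set_mem/=.
by rewrite in_itv/= andbT ltNge y0.
Qed.

(** The maximum of the two powers is [y `^ al * expR (dl * `|ln y|)]. *)
Lemma integrable_exp_weight : rho.-integrable setT
  (EFin \o (fun y => weight y * expR (dl * `|ln y|))).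
Proof.
have H : rho.-integrable (tl 0)
  (EFin \o (fun y : measurableTypeR R => (Num.max ((y : R) `^ (al - dl)) ((y : R) `^ (al + dl))))).
  apply/integrableP; split; first exact/measurable_EFinP.
  under eq_integral do rewrite /= ger0_norm ?le_max ?powR_ge0//.
  exact: moment.
have mtl : measurable (tl 0) by exact: measurable_itv.
have := (@integrable_mkcond _ _ _ rho (tl 0) _ mtl).1 H.
apply: eq_integrable => // y _; rewrite /= patchE; case: ifPn => [/set_mem|y0] /=.
  rewrite in_itv/= andbT => y0; congr EFin.
  rewrite weightE// !powR_expR// -expRD.
  have [l0|l0] := lerP 0 (ln y).
    rewrite ger0_norm// max_r; first by congr expR; ring.
    by rewrite ler_expR ler_wpM2r//; have := dl_gt0; lra.
  rewrite ltr0_norm// max_l; first by congr expR; ring.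
  by rewrite ler_expR; have := dl_gt0; nra.
rewrite weight0 ?mul0r// leNgt; apply/negP => y1; move/negP: y0; apply.
by apply/mem_set; rewrite /= in_itv/= y1.
Qed.

Lemma weighted_int_weight (f : R -> R) :
  \int[rho]_(y in tl 0) ((y : R) `^ al * f (ln y)) = weighted_int rho weight (@ln R) f.
Proof.
rewrite Rintegral_mkcond; apply: eq_Rintegral => y _.
rewrite /weight !patchE; case: ifP => //= _; by rewrite mul0r.
Qed.

Lemma nonvanishing_transform :
  (forall theta : R,
      cintegral rho (tl 0) (fun y => cpow y (Complex al theta)) != 0) <->
  (forall x, cos_transform rho weight (@ln R) x ^+ 2 + sin_transform rho weight (@ln R) x ^+ 2 != 0).
Proof.
have E th : cintegral rho (tl 0) (fun y => cpow y (Complex al th)) =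
    Complex (cos_transform rho weight (@ln R) th) (sin_transform rho weight (@ln R) th).
  rewrite /cintegral /cpow /=; congr Complex.
    exact: (weighted_int_weight (fun v => cos (th * v))).
  exact: (weighted_int_weight (fun v => sin (th * v))).
have P (a b : R) : (Complex a b != 0) = (a ^+ 2 + b ^+ 2 != 0).
  by rewrite paddr_eq0 ?sqr_ge0// !sqrf_eq0 eq_complex.
by split=> h th; have := h th; rewrite E P.
Qed.

Lemma rho_tail_pos : exists2 a : R, 0 < a & (0 < rho (tl a))%E.
Proof.
apply: contrapT => h.
have z n : rho (tl n.+1%:R^-1) = 0%E.
  apply/eqP; rewrite eq_le measure_ge0 andbT leNgt; apply/negP => p.
  by apply: h; exists n.+1%:R^-1.
have tl0 : rho (tl 0) = 0%E.
  have -> : tl 0 = \bigcup_n tl n.+1%:R^-1.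
    apply/seteqP; split => y /=.
      rewrite in_itv/= andbT => y0.
      have [n _ ny] := near_infty_natSinv_lt (PosNum y0).
      by exists n => //=; rewrite in_itv/= andbT; apply: ny => /=.
    by move=> [n _] /=; rewrite !in_itv/= !andbT; apply: lt_trans.
  apply/negligibleP; first by apply: bigcup_measurable => n _; exact: measurable_itv.
  apply: negligible_bigcup => n; apply/negligibleP; first exact: measurable_itv.
  exact: z.
have /eqP := rho_neq0; apply.
have -> : [set: measurableTypeR R] = `]-oo, 0%R]%classic `|` tl 0.
  apply/seteqP; split => y //= _; rewrite !in_itv/= andbT.
  by case: (lerP y 0); [left|right].
apply/eqP; rewrite null_set_setU//; exact: measurable_itv.
Qed.

Lemma integrable_weight_moment : rho.-integrable setT
  (EFin \o (fun y => weight y * (1 + ln y ^+ 2))).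
Proof.
exact: (integrable_second_moment weight_ge0 measurable_weight (@measurable_ln R)
  dl_gt0 integrable_exp_weight).
Qed.

Lemma integrable_weight : rho.-integrable setT (EFin \o weight).
Proof. exact: (integrable_om weight_ge0 measurable_weight integrable_weight_moment). Qed.

Lemma weight_mass_gt0 : 0 < \int[rho]_y weight y.
Proof.
have [a a0 ra] := rho_tail_pos.
have [E _] := rho_tail_le a0.
have mt : measurable (tl a) by exact: measurable_itv.
have ic : rho.-integrable (tl a) (EFin \o cst (a `^ al)).
  apply: measurable_bounded_integrable => //.
    by have := ltry (rtail rho a); rewrite -E.
  exact: bounded_cst.
apply: (@lt_le_trans _ _ (\int[rho]_(y in tl a) (a `^ al))).
  rewrite Rintegral_cst// mulr_gt0 ?powR_gt0//.
  by rewrite -[fine _]/(rtail rho a) -lte_fin -E.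
rewrite Rintegral_mkcond; apply: le_Rintegral => //.
- by rewrite -restrict_EFin; exact: (integrable_mkcond _ mt).1.
- exact: integrable_weight.
move=> y _; rewrite patchE; case: ifPn => [/set_mem|_]; last exact: weight_ge0.
rewrite /= in_itv/= andbT => ay; have y0 := lt_trans a0 ay.
rewrite weightE// -powR_expR// ge0_ler_powR ?nnegrE// ltW//.
Qed.

End Moments.

(** * Negligibility of the mass of nu below a fixed level *)
Section LogScale.
Variable R : realType.

Lemma near_expR (P : R -> Prop) :
  (\forall X \near +oo, P X) -> \forall x \near +oo, P (expR x).
Proof.
move=> [z [_ zP]]; exists z; split; first exact: num_real.
move=> x /= zx; apply: zP; apply: (lt_le_trans zx).
by apply: le_trans (expR_ge1Dx x); rewrite lerDr.
Qed.

Lemma near_ln (P : R -> Prop) :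
  (\forall x \near +oo, P x) -> \forall X \near +oo, P (ln X).
Proof.
move=> [z [_ zP]]; exists (expR z); split; first exact: num_real.
move=> X /= zX; apply: zP; rewrite -(expRK z) ltr_ln// ?posrE ?expR_gt0//.
by apply: lt_trans zX; exact: expR_gt0.
Qed.

Lemma cvg_expR_scale (f : R -> R) (a : R) :
  f X @[X --> +oo] --> a -> f (expR x) @[x --> +oo] --> a.
Proof. by move=> fa P Pa; exact: (near_expR (fa P Pa)). Qed.

Lemma cvg_ln_scale (f : R -> R) (a : R) :
  f x @[x --> +oo] --> a -> f (ln X) @[X --> +oo] --> a.
Proof. by move=> fa P Pa; exact: (near_ln (fa P Pa)). Qed.

End LogScale.

Section Forward.
Variable R : realType.
Variables nu rho : {sigma_finite_measure set (measurableTypeR R) -> \bar R}.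
Variables (al dl : R).
Hypothesis al_gt0 : 0 < al.
Hypothesis dl_gt0 : 0 < dl.
Hypothesis rho_pos : on_positives rho.
Hypothesis rho_neq0 : rho setT != 0%E.
Hypothesis moment : (\int[rho]_(y in `]0%R, +oo[%classic)
  (Num.max ((y : R) `^ (al - dl)) ((y : R) `^ (al + dl)))%:E < +oo)%E.
Local Notation tl x := (`]x%R, +oo[%classic : set (measurableTypeR R)).
Hypothesis conv_rv : rv_tail_exp al (mconv nu rho).
Local Notation t := (rtail (mconv nu rho)).

Let t_fin : \forall x \near +oo, mconv nu rho (tl x) = (t x)%:E /\ 0 < t x.
Proof. by have /rv_tail_expP[] := conv_rv. Qed.

Let t_log (s : R) : t (expR (x + s)) / t (expR x) @[x --> +oo] --> expR (- (al * s)).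
Proof.
have /rv_tail_expP[_ _ /(_ (expR s) (expR_gt0 s))] := conv_rv.
move/cvg_expR_scale; rewrite powR_expR ?expR_gt0// expRK mulNr.
by under eq_fun do rewrite -expRD addrC.
Qed.

Lemma conv_tail_lower : exists2 c : R, 0 < c &
  \forall X \near +oo, c * X `^ (- (al + dl / 2)) <= t X.
Proof.
have [z [_ zP]] := near_expR t_fin.
have mono x y : z + 1 <= x -> x <= y -> t (expR y) <= t (expR x).
  move=> zx xy.
  have zx' : z < x by apply: lt_le_trans zx; rewrite ltrDl.
  have zy' : z < y by exact: lt_le_trans xy.
  apply: fine_le; [by rewrite (zP _ zy').1|by rewrite (zP _ zx').1|].
  by apply: mconv_noninc; rewrite ler_expR.
have t1 := @t_log 1; rewrite mulr1 in t1.
have dl2 : 0 < dl / 2 by rewrite divr_gt0.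
have tpos : \forall x \near +oo, 0 < t (expR x).
  by apply: (near_expR (P := fun X => 0 < t X)); apply: filterS t_fin => x [].
have [y [_ yP]] := potter al_gt0 dl2 mono tpos t1.
have [ty0 yP'] := yP (y + 1) (ltr_pwDr ltr01 (lexx y)).
exists (expR ((al + dl / 2) * y) * t (expR (y + 1))).
  by rewrite mulr_gt0// expR_gt0.
near=> X.
have X0 : 0 < X by near: X; exact: near_pinfty_gt0.
have yX : 0 <= ln X - (y + 1).
  rewrite subr_ge0; near: X; apply: (near_ln (P := fun x => y + 1 <= x)); apply: nbhs_pinfty_ge; exact: num_real.
have [lo _] := yP' _ yX; rewrite subrKC lnK ?posrE// in lo.
apply: le_trans lo; rewrite mulrAC powR_expR// -expRD le_eqVlt; apply/orP; left.
by apply/eqP; congr (expR _ * _); ring.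
Unshelve. all: by end_near. Qed.

(** The tail of [rho] is [O (X `^ - (al + dl))] by Markov's inequality, while
    that of the convolution is at least a multiple of [X `^ - (al + dl / 2)]. *)
Lemma rho_tail_negl (b e : R) : 0 < b -> 0 < e ->
  \forall X \near +oo, rtail rho (X / b) <= e * t X.
Proof.
move=> b0 e0; have [c c0 cP] := conv_tail_lower.
have K := rho_tail_le al_gt0 dl_gt0 moment; set k := fine _ in K.
have k0 : 0 <= k.
  apply: fine_ge0; apply: integral_ge0 => y _; by rewrite lee_fin le_max powR_ge0.
pose D := k * b `^ (al + dl) / (e * c) + 1.
have D0 : 0 < D.
  by rewrite ltr_wpDl// divr_ge0// ?mulr_ge0 ?powR_ge0// ltW.
near=> X.
have X0 : 0 < X by near: X; exact: near_pinfty_gt0.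
have low : c * X `^ (- (al + dl / 2)) <= t X by near: X; exact: cP.
have XD : D <= X `^ (dl / 2).
  rewrite powR_expR//; have : ln D / (dl / 2) <= ln X.
    near: X; apply: (near_ln (P := fun x => ln D / (dl / 2) <= x)); apply: nbhs_pinfty_ge; exact: num_real.
  rewrite ler_pdivrMr ?divr_gt0// mulrC => h.
  by rewrite -{1}(lnK (_ : D \is Num.pos)) ?posrE// ler_expR.
have Xb : 0 < X / b by rewrite divr_gt0.
have [_ h] := K _ Xb.
apply: (@le_trans _ _ (e * (c * X `^ (- (al + dl / 2))))); last by rewrite ler_wpM2l// ltW.
rewrite -(ler_pM2r (powR_gt0 (al + dl) Xb)); apply: (le_trans h).
have E : (X / b) `^ (al + dl) = X `^ (al + dl) * (b `^ (al + dl))^-1.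
  rewrite !powR_expR// -expRN -expRD lnM ?posrE ?invr_gt0// lnV ?posrE//.
  by congr expR; ring.
have F : X `^ (- (al + dl / 2)) * X `^ (al + dl) = X `^ (dl / 2).
  by rewrite !powR_expR// -expRD; congr expR; field.
have bp : 0 < b `^ (al + dl) by exact: powR_gt0.
rewrite E mulrA -!mulrA mulrA (mulrA (X `^ _)) F !mulrA ler_pdivlMr//.
have : e * c * D <= e * c * X `^ (dl / 2) by rewrite ler_wpM2l// mulr_ge0// ltW.
apply: le_trans; rewrite /D mulrDr mulr1.
rewrite (_ : e * c * (k * b `^ (al + dl) / (e * c)) = k * b `^ (al + dl)).
  by rewrite lerDl mulr_ge0// ltW.
by field; rewrite !gt_eqF.
Unshelve. all: by end_near. Qed.

(** By [tail_le_mconv], since [rho] charges some [tl a]. *)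
Lemma nu_tail_fin : exists2 b0 : R, 0 < b0 & (nu (tl b0) < +oo)%E.
Proof.
have [a a0 ra] := rho_tail_pos rho_pos rho_neq0.
near (pinfty_nbhs R) => X.
have X0 : 0 < X by near: X; exact: near_pinfty_gt0.
have [TX _] : mconv nu rho (tl (a * X)) = (t (a * X))%:E /\ 0 < t (a * X).
  by near: X; exact: (near_pinfty_scale a0 t_fin).
exists X => //; have := tail_le_mconv nu rho a0 (ltW X0); rewrite TX.
case: (nu (tl X)) (measure_ge0 nu (tl X)) => [r| |] //.
  by move=> _ _; exact: ltry.
by move=> _; rewrite gt0_mulye// leye_eq.
Unshelve. all: by end_near. Qed.

Hypothesis negligible : small_factor_negligible nu rho.

Lemma small_part_near0 (e : R) : 0 < e ->
  \forall b \near 0^'+, \forall X \near +oo, (small_part nu rho b X <= (e * t X)%:E)%E.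
Proof.
move=> e0.
have /fine_cvgP[gfin /cvgrPdist_lt/(_ e e0) glt] := negligible.
near=> b.
have gb : limf_esup (fun x : R => (small_part nu rho b x / mconv nu rho (tl x))%E)
    (pinfty_nbhs R) \is a fin_num by near: b; exact: gfin.
have : `|0 - fine (limf_esup (fun x : R =>
    (small_part nu rho b x / mconv nu rho (tl x))%E) (pinfty_nbhs R))| < e.
  by near: b; exact: glt.
rewrite sub0r normrN => /(le_lt_trans (ler_norm _)).
rewrite -lte_fin fineK// => /ereal_inf_lt[_ [V nV <-] Ve].
apply: filterS2 nV t_fin => X VX [TX t0].
have : (small_part nu rho b X / mconv nu rho (tl X) < e%:E)%E.
  by apply: le_lt_trans Ve; apply: ereal_sup_ubound; exists X.
rewrite TX inver gt_eqF// => /ltW h.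
have := lee_wpmul2r (ltW t0 : (0 <= (t X)%:E)%E) h.
by rewrite -muleA -EFinM mulVf ?gt_eqF// mule1 EFinM.
Unshelve. all: by end_near. Qed.

Lemma small_part_le (b' b X : R) : 0 < b' -> b' < b -> 0 < X ->
  (small_part nu rho b X <=
   small_part nu rho b' X + rho (tl (X / b)%R) * nu `]b', b]%classic)%E.
Proof.
move=> b'0 b'b X0; have b0 : 0 < b by exact: lt_trans b'b.
have mf : measurable_fun (tl 0) (fun y => rho (tl (X / y))).
  have := @measurable_conv_section R rho X setT measurableT.
  by apply: eq_measurable_fun => y _; rewrite setIT.
have mi (i : interval R) : measurable ([set` i] : set (measurableTypeR R)).
  exact: measurable_itv.
rewrite /small_part (@itv_bndbnd_setU _ _ _ (BRight b')); [|by rewrite bnd_simp ltW|by rewrite bnd_simp ltW].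
rewrite ge0_integral_setU//; first last.
- rewrite disj_set2E; apply/eqP/seteqP; split => y //=.
  by rewrite !in_itv/= => -[/andP[_ yb'] /andP[]]; rewrite ltNge yb'.
- apply: measurable_funS mf => //.
  move=> y /= [] /=; rewrite !in_itv/= andbT => /andP[]//.
  by move=> h _; exact: lt_trans h.
apply: leeD => //; rewrite -integral_cst//; apply: ge0_le_integral => //.
- apply: measurable_funS mf => // y /=.
  by rewrite !in_itv/= andbT => /andP[h _]; exact: lt_trans h.
- move=> y /=; rewrite in_itv/= => /andP[h yb].
  apply: le_measure; rewrite ?inE//; apply: subset_itvr; rewrite bnd_simp.
  by rewrite ler_pM2l// lef_pV2 ?posrE//; exact: lt_trans h.
Qed.

(** Beyond a fixed [b'], enlarging [b] changes nothing asymptotically: the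
    additional mass is either invisible, when [rho] has bounded support, or
    finite, and then weighted by a tail of [rho] that decays faster. *)
Lemma small_part_negl (b e : R) : 0 < b -> 0 < e ->
  \forall X \near +oo, (small_part nu rho b X <= (e * t X)%:E)%E.
Proof.
move=> b0 e0.
have mi (i : interval R) : measurable ([set` i] : set (measurableTypeR R)).
  exact: measurable_itv.
have [[z z0 rz]|unbounded] := pselect (exists2 z : R, 0 < z & rho (tl z) = 0%E).
  near=> X.
  have [_ t0] : mconv nu rho (tl X) = (t X)%:E /\ 0 < t X by near: X; exact: t_fin.
  have zX : z <= X / b.
    rewrite ler_pdivlMr//; near: X; apply: nbhs_pinfty_ge; exact: num_real.
  have X0 : 0 < X by near: X; exact: near_pinfty_gt0.
  rewrite /small_part integral0_eq ?lee_fin ?mulr_ge0 ?ltW//.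
  move=> y /=; rewrite in_itv/= => /andP[y0 yb].
  apply/eqP; rewrite eq_le measure_ge0 andbT -rz.
  apply: le_measure; rewrite ?inE//; apply: subset_itvr; rewrite bnd_simp.
  apply: (le_trans zX); by rewrite ler_pM2l// lef_pV2 ?posrE//.
have e2 : 0 < e / 2 by rewrite divr_gt0.
near (0 : R)^'+ => b'.
have b'0 : 0 < b' by near: b'; exact: nbhs_right_gt.
have b'b : b' < b by near: b'; exact: nbhs_right_lt.
have sb' : \forall X \near +oo, (small_part nu rho b' X <= (e / 2 * t X)%:E)%E.
  by near: b'; exact: small_part_near0.
have nub' : (nu (tl b') < +oo)%E.
  near (pinfty_nbhs R) => X.
  have X0 : 0 < X by near: X; exact: near_pinfty_gt0.
  have [TX _] : mconv nu rho (tl X) = (t X)%:E /\ 0 < t X by near: X; exact: t_fin.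
  have Xb' : 0 < X / b' by rewrite divr_gt0.
  have rX : (0 < rho (tl (X / b')))%E.
    rewrite lt0e measure_ge0 andbT; apply/eqP => h; apply: unbounded.
    by exists (X / b').
  have := tail_le_mconv nu rho Xb' (ltW b'0); rewrite divfK ?gt_eqF// TX.
  case: (nu (tl b')) (measure_ge0 nu (tl b')) => [r| |] //.
    by move=> _ _; exact: ltry.
  by move=> _; rewrite gt0_mulye// leye_eq.
have nubb : nu `]b', b]%classic \is a fin_num.
  rewrite ge0_fin_numE//; apply: le_lt_trans nub'.
  by apply: le_measure; rewrite ?inE//; apply: subset_itvl.
pose C := fine (nu `]b', b]%classic).
have C0 : 0 <= C by exact: fine_ge0.
have eC : 0 < e / 2 / (C + 1) by rewrite divr_gt0// ltr_wpDl.
have rn := rho_tail_negl b0 eC.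
near=> X.
have X0 : 0 < X by near: X; exact: near_pinfty_gt0.
have [_ t0] : mconv nu rho (tl X) = (t X)%:E /\ 0 < t X by near: X; exact: t_fin.
have h1 : (small_part nu rho b' X <= (e / 2 * t X)%:E)%E by near: X; exact: sb'.
have h2 : rtail rho (X / b) <= e / 2 / (C + 1) * t X by near: X; exact: rn.
apply: (le_trans (small_part_le b'0 b'b X0)).
have Xb : 0 < X / b by rewrite divr_gt0.
have [-> _] := rho_tail_le al_gt0 dl_gt0 moment Xb.
rewrite (_ : e * t X = e / 2 * t X + e / 2 * t X); last by field.
rewrite EFinD; apply: leeD => //.
rewrite -(fineK nubb) -/C -EFinM lee_fin.
apply: (@le_trans _ _ (e / 2 / (C + 1) * t X * C)); first by rewrite ler_wpM2r.
rewrite (_ : e / 2 / (C + 1) * t X * C = e / 2 * t X * (C / (C + 1))); last by ring.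
apply: ler_piMr; first by rewrite mulr_ge0// ltW.
by rewrite ler_pdivrMr ?mul1r ?lerDl// ltr_wpDl.
Unshelve. all: by end_near. Qed.

End Forward.

(** * Regular variation of the factor *)
Lemma ratio_chain (F : fieldType) (a b c e : F) : b != 0 -> c != 0 -> e != 0 ->
  a / b * (b / c) * (e / c)^-1 = a / e.
Proof. by move=> b0 c0 e0; field; rewrite b0 c0 e0. Qed.

Section ForwardConclusion.
Variable R : realType.
Variables nu rho : {sigma_finite_measure set (measurableTypeR R) -> \bar R}.
Variables (al dl : R).
Hypothesis al_gt0 : 0 < al.
Hypothesis dl_gt0 : 0 < dl.
Hypothesis rho_pos : on_positives rho.
Hypothesis rho_neq0 : rho setT != 0%E.
Hypothesis moment : (\int[rho]_(y in `]0%R, +oo[%classic)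
  (Num.max ((y : R) `^ (al - dl)) ((y : R) `^ (al + dl)))%:E < +oo)%E.
Local Notation tl x := (`]x%R, +oo[%classic : set (measurableTypeR R)).
Hypothesis conv_rv : rv_tail_exp al (mconv nu rho).
Hypothesis negligible : small_factor_negligible nu rho.
Hypothesis nonvanishing : forall theta : R,
  cintegral rho (tl 0) (fun y => cpow y (Complex al theta)) != 0.
Local Notation t := (rtail (mconv nu rho)).

Let t_fin : \forall x \near +oo, mconv nu rho (tl x) = (t x)%:E /\ 0 < t x.
Proof. by have /rv_tail_expP[] := conv_rv. Qed.

Let mi (i : interval R) : measurable ([set` i] : set (measurableTypeR R)).
Proof. exact: measurable_itv. Qed.

Section Cutoff.
Variable b0 : R.
Hypothesis b0_gt0 : 0 < b0.
Hypothesis nub0 : (nu (tl b0) < +oo)%E.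

(** Cutting [nu] off below [b0] makes its tail bounded, as
    [tauberian_tail_ratio] requires; beyond [b0] nothing changes. *)
Definition cut_tail (v : R) : R := fine (nu (tl (expR v) `&` tl b0)).

Let cut_le v : (nu (tl (expR v) `&` tl b0) <= nu (tl b0))%E.
Proof.
apply: le_measure; rewrite ?inE//; try exact: measurableI.
Qed.

Let cut_fin v : nu (tl (expR v) `&` tl b0) \is a fin_num.
Proof. by rewrite ge0_fin_numE//; exact: le_lt_trans nub0. Qed.

Let b0_fin : nu (tl b0) \is a fin_num.
Proof. by rewrite ge0_fin_numE. Qed.

Let cut_ge0 v : 0 <= cut_tail v.
Proof. exact: fine_ge0. Qed.

Let cut_bounded v : cut_tail v <= fine (nu (tl b0)).
Proof. exact: fine_le. Qed.

Let cut_noninc v w : v <= w -> cut_tail w <= cut_tail v.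
Proof.
move=> vw; apply: fine_le => //.
apply: le_measure; rewrite ?inE//; try exact: measurableI.
by apply: setSI; apply: subset_itvr; rewrite bnd_simp ler_expR.
Qed.

Let N := cut_tail.
Let M := tail_conv rho (weight al) (@ln R) al N.

Let integrandE (x : R) : (fun y => weight al y * (expR (- (al * ln y)) * N (x - ln y)))
   = (fun y : R => N (x - ln y)) \_ (tl 0).
Proof.
apply/funext => y; rewrite patchE; case: ifPn => [/set_mem|y0] /=.
  by rewrite in_itv/= andbT => y0; rewrite weightE// mulrA -expRD addrN expR0 mul1r.
rewrite weight0 ?mul0r// leNgt; apply/negP => y1; move/negP: y0; apply.
by apply/mem_set; rewrite /= in_itv/= y1.
Qed.

Let large_partE x : large_part nu rho b0 (expR x) =
  (\int[rho]_(y in tl 0) (N (x - ln y))%:E)%E.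
Proof.
apply: eq_integral => y /set_mem/=; rewrite in_itv/= andbT => y0.
rewrite /N /cut_tail fineK ?cut_fin//; congr (nu (_ `&` _)).
by rewrite expRD expRN lnK ?posrE.
Qed.

Let mN x : measurable_fun (tl 0) (fun y : measurableTypeR R => N (x - ln y)).
Proof.
apply: measurable_funTS; apply: measurableT_comp.
  by apply: nonincreasing_measurable => // v w; exact: cut_noninc.
by apply: measurable_funB => //; exact: measurable_ln.
Qed.

Let large_int x : (large_part nu rho b0 (expR x) < +oo)%E ->
  rho.-integrable setT
    (EFin \o (fun y => weight al y * (expR (- (al * ln y)) * N (x - ln y)))).
Proof.
rewrite large_partE => fin; rewrite integrandE -restrict_EFin.
apply: (@integrable_mkcond _ _ _ rho (tl 0) _ (mi _)).1.
apply/integrableP; split; first exact/measurable_EFinP.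
by under eq_integral do rewrite /= ger0_norm//.
Qed.

Let ME x : M x = fine (large_part nu rho b0 (expR x)).
Proof.
rewrite large_partE /M /tail_conv /weighted_int.
rewrite -[RHS]/(\int[rho]_(y in tl 0) N (x - ln y)) [RHS]Rintegral_mkcond.
by apply: eq_Rintegral => y _; exact: (congr1 (@^~ y) (integrandE x)).
Qed.

Let M_close (e : R) : 0 < e -> \forall x \near +oo,
  [/\ (large_part nu rho b0 (expR x) < +oo)%E, 0 < t (expR x),
    (1 - e) * t (expR x) <= M x & M x <= t (expR x)].
Proof.
move=> e0; have sm := small_part_negl al_gt0 dl_gt0 moment conv_rv negligible b0_gt0 e0.
near=> x; rewrite ME.
have [TX t0] : mconv nu rho (tl (expR x)) = (t (expR x))%:E /\ 0 < t (expR x).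
  by near: x; exact: near_expR t_fin.
have sX : (small_part nu rho b0 (expR x) <= (e * t (expR x))%:E)%E.
  near: x; exact: near_expR sm.
have L0 : (0 <= large_part nu rho b0 (expR x))%E by exact: integral_ge0.
have S0 : (0 <= small_part nu rho b0 (expR x))%E by exact: integral_ge0.
have sp := mconv_split nu rho (expR_gt0 x) b0_gt0; rewrite TX in sp.
have Sfin : small_part nu rho b0 (expR x) \is a fin_num.
  by rewrite ge0_fin_numE//; apply: le_lt_trans sX _; exact: ltry.
have Lfin : large_part nu rho b0 (expR x) \is a fin_num.
  rewrite ge0_fin_numE//; apply: le_lt_trans (ltry (t (expR x))).
  by rewrite sp leeDr.
rewrite -(fineK Sfin) in sX S0 sp; rewrite -(fineK Lfin) in sp L0 *.
rewrite lee_fin in sX; rewrite lee_fin in S0; rewrite lee_fin in L0.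
move: sp; rewrite -EFinD => -[sp].
split => //=; [exact: ltry|rewrite mulrBl mul1r; lra|lra].
Unshelve. all: by end_near. Qed.

Let M_gt0 : \forall x \near +oo, 0 < M x.
Proof.
have h : (0 : R) < 2^-1 by rewrite invr_gt0.
apply: filterS (M_close h) => x [_ t0 + _]; apply: lt_le_trans.
by rewrite mulr_gt0//; lra.
Qed.

Let M_ratio : M x / t (expR x) @[x --> +oo] --> (1 : R).
Proof.
apply/cvgrPdist_le => e e0; apply: filterS (M_close e0) => x [_ t0 l u] /=.
rewrite distrC ler_distl; apply/andP; split.
  by rewrite ler_pdivlMr.
rewrite ler_pdivrMr//; apply: (le_trans u).
by rewrite mulrDl mul1r lerDl mulr_ge0// ltW.
Qed.

Let M_rv (s : R) : M (x + s) / M x @[x --> +oo] --> expR (- (al * s)).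
Proof.
have /rv_tail_expP[_ _ /(_ (expR s) (expR_gt0 s))] := conv_rv.
move/cvg_expR_scale; rewrite powR_expR ?expR_gt0// expRK mulNr => tr.
have Ms : M (x + s) / t (expR (x + s)) @[x --> +oo] --> (1 : R).
  have := M_ratio => h P /h; case=> z [_ zP]; exists (z - s); split; first exact: num_real.
  by move=> x /=; rewrite ltrBlDr; exact: zP.
have lim : M (x + s) / t (expR (x + s)) * (t (expR s * expR x) / t (expR x)) *
    (M x / t (expR x))^-1 @[x --> +oo] --> 1 * expR (- (al * s)) * 1^-1.
  exact: (cvgM (cvgM Ms tr) (cvgV (oner_neq0 R) M_ratio)).
rewrite mul1r invr1 mulr1 in lim.
apply: cvg_trans lim; apply: near_eq_cvg.
near=> x.
have t0 : 0 < t (expR x).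
  near: x; apply: (near_expR (P := fun X => 0 < t X)).
  by apply: filterS t_fin => X [].
have t1 : 0 < t (expR (x + s)).
  rewrite expRD mulrC; near: x.
  apply: (near_expR (P := fun X => 0 < t (expR s * X))).
  by apply: filterS (near_pinfty_scale (expR_gt0 s) t_fin) => X [].
have M0 : 0 < M x by near: x; exact: M_gt0.
have Es : expR s * expR x = expR (x + s) by rewrite -expRD addrC.
rewrite Es.
exact: (ratio_chain (M (x + s)) (lt0r_neq0 t1) (lt0r_neq0 t0) (lt0r_neq0 M0)).
Unshelve. all: by end_near. Qed.

Lemma cut_tail_ratio :
  cut_tail x / t (expR x) @[x --> +oo] --> (\int[rho]_y weight al y)^-1.
Proof.
have [X0 [_ X0P]] : \forall x \near +oo, (large_part nu rho b0 (expR x) < +oo)%E.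
  by apply: filterS (M_close ltr01) => x [].
have X1 x : X0 + 1 <= x -> (large_part nu rho b0 (expR x) < +oo)%E.
  by move=> h; apply: X0P; apply: lt_le_trans h; rewrite ltrDl.
have := tauberian_tail_ratio (@weight_ge0 R al) (@measurable_weight R al)
  (@measurable_ln R) al_gt0 dl_gt0 (integrable_exp_weight dl_gt0 moment)
  ((nonvanishing_transform rho al).1 nonvanishing)
  cut_ge0 cut_bounded cut_noninc (fun x h => large_int (X1 x h)) M_gt0 M_rv.
move=> NM.
have lim : cut_tail x / M x * (M x / t (expR x)) @[x --> +oo] -->
    (\int[rho]_y weight al y)^-1 * 1 by exact: (cvgM NM M_ratio).
rewrite mulr1 in lim; apply: cvg_trans lim; apply: near_eq_cvg; near=> x.
have M0 : 0 < M x by near: x; exact: M_gt0.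
by rewrite /= mulrA divfK// gt_eqF.
Unshelve. all: by end_near. Qed.

End Cutoff.

Let W_gt0 := weight_mass_gt0 al_gt0 dl_gt0 rho_pos rho_neq0 moment.

Lemma tail_ratio : (\forall x \near +oo, nu (tl x) = (rtail nu x)%:E) /\
  rtail nu x / t x @[x --> +oo] --> (\int[rho]_y weight al y)^-1.
Proof.
have [b0 b00 nub0] := nu_tail_fin rho_pos rho_neq0 conv_rv.
split.
  near=> x; rewrite /rtail fineK// ge0_fin_numE//; apply: le_lt_trans nub0.
  apply: le_measure; rewrite ?inE//; apply: subset_itvr; rewrite bnd_simp.
  near: x; apply: nbhs_pinfty_ge; exact: num_real.
apply: cvg_trans (cvg_ln_scale (cut_tail_ratio b00 nub0)).
apply: near_eq_cvg; near=> x.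
have x0 : 0 < x by near: x; exact: near_pinfty_gt0.
rewrite /cut_tail lnK ?posrE// /rtail; congr (fine (nu _) / _).
apply/setIidl; apply: subset_itvr; rewrite bnd_simp.
near: x; apply: nbhs_pinfty_ge; exact: num_real.
Unshelve. all: by end_near. Qed.

Lemma tail_ratio_gt0 : \forall x \near +oo, 0 < rtail nu x.
Proof.
have [_ r] := tail_ratio; have W0 := W_gt0.
have Wi : 0 < (\int[rho]_y weight al y)^-1 by rewrite invr_gt0.
have pos := cvgr_gt _ r _ Wi; near=> x.
have t0 : 0 < t x by near: x; apply: filterS t_fin => X [].
have : 0 < rtail nu x / t x by near: x; exact: pos.
by rewrite pmulr_lgt0// invr_gt0.
Unshelve. all: by end_near. Qed.

Lemma factor_rv_tail : rv_tail_exp al nu.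
Proof.
have [nf r] := tail_ratio; have W0 := W_gt0.
apply/rv_tail_expP; split.
- exact: ltW.
- near=> x; split; first by near: x; exact: nf.
  by near: x; exact: tail_ratio_gt0.
- move=> c c0; have /rv_tail_expP[_ _ /(_ c c0) tr] := conv_rv.
  have rc : rtail nu (c * x) / t (c * x) @[x --> +oo] --> (\int[rho]_y weight al y)^-1.
    by move=> P Pa; exact: (near_pinfty_scale c0 (r P Pa)).
  have Wn : (\int[rho]_y weight al y)^-1 != 0 by rewrite invr_neq0// gt_eqF.
  have lim : rtail nu (c * x) / t (c * x) * (t (c * x) / t x) *
      (rtail nu x / t x)^-1 @[x --> +oo] -->
      (\int[rho]_y weight al y)^-1 * c `^ (- al) * (\int[rho]_y weight al y)^-1^-1.
    exact: (cvgM (cvgM rc tr) (cvgV Wn r)).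
  rewrite mulrAC divff// mul1r in lim.
  apply: cvg_trans lim; apply: near_eq_cvg; near=> x.
  have t0 : 0 < t x by near: x; apply: filterS t_fin => X [].
  have t1 : 0 < t (c * x).
    by near: x; apply: filterS (near_pinfty_scale c0 t_fin) => X [].
  have n0 : 0 < rtail nu x by near: x; exact: tail_ratio_gt0.
  by rewrite /= ratio_chain// gt_eqF.
Unshelve. all: by end_near. Qed.

Lemma mconv_tail_ratio :
  (mconv nu rho (tl x) / nu (tl x))%E @[x --> +oo] -->
  (\int[rho]_(y in tl 0) ((y : R) `^ al)%:E)%E.
Proof.
have [nf r] := tail_ratio; have W0 := W_gt0.
have iw := integrable_weight dl_gt0 moment.
have -> : (\int[rho]_(y in tl 0) ((y : R) `^ al)%:E)%E = (\int[rho]_y weight al y)%:E.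
  rewrite /Rintegral fineK; last exact: integrable_fin_num iw.
  by rewrite [LHS]integral_mkcond; apply: eq_integral => y _; rewrite /weight !patchE; case: ifP.
have Wn : (\int[rho]_y weight al y)^-1 != 0 by rewrite invr_neq0// gt_eqF.
have c : (rtail nu x / t x)^-1 @[x --> +oo] --> (\int[rho]_y weight al y)^-1^-1.
  exact: (cvgV Wn r).
rewrite invrK in c.
have E : \forall x \near +oo, (mconv nu rho (tl x) / nu (tl x))%E = (t x / rtail nu x)%:E.
  near=> x.
  have -> : nu (tl x) = (rtail nu x)%:E by near: x; exact: nf.
  have [-> _] : mconv nu rho (tl x) = (t x)%:E /\ 0 < t x by near: x; exact: t_fin.
  have n0 : 0 < rtail nu x by near: x; exact: tail_ratio_gt0.
  by rewrite inver gt_eqF.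
apply/fine_cvgP; split; first by apply: filterS E => x ->.
apply: cvg_trans c; apply: near_eq_cvg; apply: filterS E => x /= ->.
by rewrite invf_div.
Unshelve. all: by end_near. Qed.

End ForwardConclusion.

(** * An oscillating tail *)
Section Oscillation.
Variable R : realType.
Local Notation tl x := (`]x%R, +oo[%classic : set (measurableTypeR R)).

Lemma is_derive_expR_comp (f : R -> R) (x d : R) : is_derive x 1 f d ->
  is_derive x 1 (fun y => expR (f y)) (expR (f x) * d).
Proof. by move=> df; exact: (is_derive1_comp (is_derive_expR (f x)) df). Qed.

(** The power tail with a periodic perturbation, in logarithmic coordinates. *)
Definition osc_tail (al th a u : R) : R := expR (- (al * u)) * (1 + a * cos (th * u)).

Variables (al th a : R).
Hypothesis al_gt0 : 0 < al.
Hypothesis th_gt0 : 0 < th.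
Hypothesis a_gt0 : 0 < a.
(** This makes [osc] nonincreasing. *)
Hypothesis a_small : a * (al + th) <= al.

Local Notation osc := (osc_tail al th a).

Let a_lt1 : a < 1.
Proof. by have := al_gt0; have := th_gt0; have := a_gt0; have := a_small; nra. Qed.

Lemma osc_factor_gt0 u : 0 < 1 + a * cos (th * u).
Proof. by have := cos_geN1 (th * u); have := a_lt1; have := a_gt0; nra. Qed.

Lemma osc_gt0 u : 0 < osc u.
Proof. by rewrite mulr_gt0 ?expR_gt0 ?osc_factor_gt0. Qed.

Lemma osc_le u : osc u <= 2 * expR (- (al * u)).
Proof.
rewrite /osc_tail mulrC ler_wpM2r ?expR_ge0//.
by have := cos_le1 (th * u); have := a_lt1; have := a_gt0; nra.
Qed.

Let dosc u := expR (- (al * u)) * (al * (1 + a * cos (th * u)) + a * th * sin (th * u)).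

Let is_derive_osc (x : R) : is_derive x 1 (fun u => - osc u) (dosc x).
Proof.
have dal := is_derive_affine 0 (- al) x.
have de := is_derive_expR_comp dal.
have dc := is_derive_cos_comp (is_derive_affine 0 th x).
have dac := is_derive_mul (@is_derive_cst _ _ _ (- a) x 1) dc.
have dd := is_derive_add (@is_derive_cst _ _ _ (- 1 : R) x 1) dac.
have := is_derive_mul de dd.
have -> : (fun y => expR (0 + - al * y) * (cst (- 1) y + cst (- a) y * cos (0 + th * y))) =
   (fun u => - osc u).
  by apply/funext => y; rewrite /osc_tail /cst !add0r mulNr; ring.
by apply: is_derive_value; rewrite /dosc /cst !add0r mulNr; ring.
Qed.

Let continuous_dosc : continuous dosc.
Proof.
have ce : continuous (fun u : R => expR (- (al * u))).
  move=> x; apply: (@continuous_comp _ _ _ (fun u : R => - (al * u)) expR x).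
    by apply: cvgN; apply: cvgM; [exact: cvg_cst|exact: cvg_id].
  exact: continuous_expR.
have cl : continuous (fun u : R => th * u).
  by move=> x; apply: cvgM; [exact: cvg_cst|exact: cvg_id].
have cc : continuous (fun u : R => cos (th * u)).
  by move=> x; apply: (@continuous_comp _ _ _ (fun u : R => th * u) cos x);
    [exact: cl|exact: continuous_cos].
have cs : continuous (fun u : R => sin (th * u)).
  by move=> x; apply: (@continuous_comp _ _ _ (fun u : R => th * u) sin x);
    [exact: cl|exact: continuous_sin].
move=> x; apply: cvgM; first exact: ce.
apply: cvgD; (apply: cvgM; first exact: cvg_cst); last exact: cs.
by apply: cvgD; [exact: cvg_cst|apply: cvgM; [exact: cvg_cst|exact: cc]].
Qed.

Let dosc_ge0 x : 0 <= dosc x.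
Proof.
rewrite mulr_ge0 ?expR_ge0//.
have c1 := cos_geN1 (th * x); have s1 := sin_geN1 (th * x).
have h1 : 0 <= a * al * (1 + cos (th * x)).
  by apply: mulr_ge0; [apply: mulr_ge0; exact: ltW|lra].
have h2 : 0 <= a * th * (1 + sin (th * x)).
  by apply: mulr_ge0; [apply: mulr_ge0; exact: ltW|lra].
have := a_small; lra.
Qed.

Let cumul_nd : {homo (fun u => - osc u) : x y / x <= y}.
Proof.
move=> x y; rewrite le_eqVlt => /orP[/eqP->//|xy].
rewrite -subr_ge0 -(Rintegral_derivative xy is_derive_osc continuous_dosc).
exact: Rintegral_ge0.
Qed.

Lemma continuous_osc : continuous (fun u => - osc u).
Proof. by apply: C1_continuous; exists dosc. Qed.

Let cumul_rc : right_continuous (fun u => - osc u).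
Proof. exact/right_continuousW/continuous_osc. Qed.

Definition osc_cumulative (u : R) : R := - osc u.

HB.instance Definition _ :=
  isCumulative.Build R _ R osc_cumulative cumul_nd cumul_rc.

Let LS := lebesgue_stieltjes_measure osc_cumulative.

Lemma osc_cvg0 : osc x @[x --> +oo] --> (0 : R).
Proof.
have e0 : 2 * expR (- (al * x)) @[x --> +oo] --> (0 : R).
  rewrite -(mulr0 2); apply: cvgM; first exact: cvg_cst.
  by move=> P /cvgr_expR /(near_pinfty_scale al_gt0).
apply: (@squeeze_cvgr _ _ _ _ (cst 0) (fun x => 2 * expR (- (al * x)))) => //.
- by near=> x; rewrite (ltW (osc_gt0 x)) osc_le.
- exact: cvg_cst.
Unshelve. all: by end_near. Qed.

Lemma LS_ray u : LS (tl u) = (osc u)%:E.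
Proof.
have E : tl u = \bigcup_n `]u, u + n%:R]%classic.
  apply/seteqP; split => y /=.
    rewrite in_itv/= andbT => uy.
    exists (Num.bound `|y - u|) => //=; rewrite in_itv/= uy/= -lerBlDl.
    exact: (le_trans (ler_norm _) (ltW (archi_boundP (normr_ge0 _)))).
  by move=> [n _] /=; rewrite !in_itv/= andbT => /andP[].
have mi (i : interval R) : measurable ([set` i] : set (measurableTypeR R)).
  exact: measurable_itv.
have val n : LS `]u, u + n%:R]%classic = (osc u - osc (u + n%:R))%:E.
  rewrite /LS/= /lebesgue_stieltjes_measure/= /measure_extension/=.
  rewrite measurable_mu_extE//=; last exact: is_ocitv.
  by rewrite wlength_itv_bnd ?lerDl// /osc_cumulative opprK addrC.
have c1 : LS `]u, u + n%:R]%classic @[n --> \oo] --> LS (tl u).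
  rewrite E; apply: nondecreasing_cvg_mu => //.
  - by rewrite -E.
  - move=> n m nm; apply/subsetPset => y /=; rewrite !in_itv/= => /andP[-> h]/=.
    by apply: (le_trans h); rewrite lerD2l ler_nat.
have c2 : LS `]u, u + n%:R]%classic @[n --> \oo] --> (osc u)%:E.
  under eq_fun do rewrite val.
  apply/fine_cvgP; split; first exact: nearW.
  rewrite /comp/= -[X in _ --> X]subr0; apply: cvgB; first exact: cvg_cst.
  have /cvg_pinftyP := osc_cvg0; apply.
  apply/cvgryPge => A; near=> n; rewrite -lerBlDl.
  by near: n; exact: nbhs_infty_ger.
exact: (cvg_unique _ c1 c2).
Unshelve. all: by end_near. Qed.

Definition mexp : measurableTypeR R -> measurableTypeR R := @expR R.

Let mmexp : measurable_fun setT mexp.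
Proof. exact: (continuous_measurable_fun (@continuous_expR R)). Qed.

(** The tail blows up at the origin, so the Stieltjes measure is built in
    logarithmic coordinates, where its distribution function is finite, and then
    transported by the exponential. *)
Definition osc_measure : set (measurableTypeR R) -> \bar R := pushforward LS mexp.

HB.instance Definition _ := Measure.copy osc_measure
  (measure_function_pushforward__canonical__measure_function_Measure LS mmexp).

Lemma osc_measure_neg : osc_measure `]-oo, 0%R]%classic = 0%E.
Proof.
rewrite /osc_measure /pushforward (_ : _ @^-1` _ = set0) ?measure0//.
apply/seteqP; split => y //=; rewrite in_itv/= => h.
by have := expR_gt0 y; rewrite /mexp in h; rewrite ltNge h.
Qed.

Lemma osc_measure_tail X : 0 < X -> osc_measure (tl X) = (osc (ln X))%:E.
Proof.
move=> X0; rewrite -LS_ray /osc_measure /pushforward; congr (LS _).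
apply/seteqP; split => y /=; rewrite !in_itv/= !andbT /mexp.
  by move=> h; rewrite -(expRK y) ltr_ln// posrE ?expR_gt0.
by rewrite -{2}(lnK (_ : X \is Num.pos)) ?posrE// ltr_expR.
Qed.

Let osc_sigma_finite : sigma_finite setT osc_measure.
Proof.
have mi (i : interval R) : measurable ([set` i] : set (measurableTypeR R)).
  exact: measurable_itv.
exists (fun k : nat => `]-oo, 0%R]%classic `|` tl k.+1%:R^-1).
  apply/seteqP; split => y //= _.
  have [y0|y0] := lerP y 0; first by exists 0%N => //; left; rewrite /= in_itv/=.
  have [n _ ny] := near_infty_natSinv_lt (PosNum y0).
  by exists n => //=; right; rewrite /= in_itv/= andbT; apply: ny => /=.
move=> k; split; first exact: measurableU.
apply: (@le_lt_trans _ _ (osc_measure `]-oo, 0%R]%classic + osc_measure (tl k.+1%:R^-1))%E).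
  exact: measureU2.
rewrite osc_measure_neg add0e osc_measure_tail ?ltry//.
Qed.

HB.instance Definition _ := @Measure_isSigmaFinite.Build _ _ _ osc_measure osc_sigma_finite.

Definition oscM : {sigma_finite_measure set (measurableTypeR R) -> \bar R} := osc_measure.

(** In logarithmic coordinates the ratio of the tail at [s + x] and at [x] is
    periodic in [x]; if it converges it is constant.  With [s] half a period, its
    values at [0] and [s] would give [(1 + a) ^ 2 = (1 - a) ^ 2]. *)
Lemma osc_not_rv : ~ rv_tail oscM.
Proof.
move=> [be /rv_tail_expP[_ _ r]].
pose s := pi / th.
pose p : R := (pi *+ 2) / th.
have p0 : 0 < p by rewrite divr_gt0// mulr2n addr_gt0// pi_gt0.
have /cvg_expR_scale rs := r (expR s) (expR_gt0 s).
have Et x : rtail oscM (expR x) = osc x.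
  rewrite -[RHS](congr1 osc (expRK x)).
  exact: (congr1 fine (osc_measure_tail (expR_gt0 x))).
have E x : rtail oscM (expR s * expR x) / rtail oscM (expR x) = osc (s + x) / osc x.
  by rewrite -expRD !Et.
have per x : osc (s + x) / osc x = expR s `^ (- be).
  have /cvg_pinftyP := rs => /(_ (fun n => x + p * n%:R)) h.
  have xy : (x + p * n%:R) @[n --> \oo] --> +oo.
    apply/cvgryPge => A; near=> n.
    rewrite -lerBlDl -ler_pdivrMl//.
    by near: n; exact: nbhs_infty_ger.
  have := h xy; under eq_fun do rewrite E.
  have -> : (fun n => osc (s + (x + p * n%:R)) / osc (x + p * n%:R))
     = (fun n : nat => osc (s + x) / osc x).
    apply/funext => n; rewrite /osc_tail.
    have cosn y : cos (th * (y + p * n%:R)) = cos (th * y).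
      rewrite mulrDr (_ : th * (p * n%:R) = pi *+ 2 *+ n); last first.
        by rewrite -[in RHS]mulr_natr /p; field; rewrite gt_eqF.
      exact: (periodicn (@cosD2pi R)).
    rewrite addrA !cosn.
    rewrite [X in X / _](_ : _ = expR (- (al * (p * n%:R))) *
       (expR (- (al * (s + x))) * (1 + a * cos (th * (s + x))))); last first.
      by rewrite mulrA -expRD; congr (expR _ * _); ring.
    rewrite [X in _ / X](_ : _ = expR (- (al * (p * n%:R))) *
       (expR (- (al * x)) * (1 + a * cos (th * x)))); last first.
      by rewrite mulrA -expRD; congr (expR _ * _); ring.
    rewrite -mulf_div divff ?mul1r// gt_eqF// expR_gt0//.
  by move=> /(cvg_unique _ (@cvg_cst _ _ _ _ _)) ->.
have := per s; rewrite -(per 0) addr0 /osc_tail.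
have -> : th * s = pi by rewrite /s; field; rewrite gt_eqF.
have -> : th * (s + s) = pi *+ 2 by rewrite /s; field; rewrite gt_eqF.
rewrite !mulr0 cos0 cospi cos2pi oppr0 expR0.
have -> : expR (- (al * (s + s))) = expR (- (al * s)) * expR (- (al * s)).
  by rewrite -expRD; congr expR; ring.
have := expR_gt0 (- (al * s)); move: (expR _) => z z0 h.
have := a_lt1; have := a_gt0 => a0 a1.
have n1 : 1 - a != 0 by rewrite gt_eqF// subr_gt0.
have n2 : 1 + a != 0 by rewrite gt_eqF// addr_gt0.
have zn : z != 0 by rewrite gt_eqF.
have := congr1 (fun w => w * ((1 - a) * (1 + a) / z)) h.
have -> : z * z * (1 + a * 1) / (z * (1 + a * -1)) * ((1 - a) * (1 + a) / z) = (1 + a) ^+ 2.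
  by rewrite mulr1 mulrN1; field; rewrite zn n1.
have -> : z * (1 + a * -1) / (1 * (1 + a * 1)) * ((1 - a) * (1 + a) / z) = (1 - a) ^+ 2.
  by rewrite mul1r mulr1 mulrN1; field; rewrite zn n2.
nra.
Unshelve. all: by end_near. Qed.

End Oscillation.

(** * The converse *)
Section Converse.
Variable R : realType.
Variable rho : {sigma_finite_measure set (measurableTypeR R) -> \bar R}.
Variables (al dl : R).
Hypothesis al_gt0 : 0 < al.
Hypothesis dl_gt0 : 0 < dl.
Hypothesis rho_pos : on_positives rho.
Hypothesis rho_neq0 : rho setT != 0%E.
Hypothesis moment : (\int[rho]_(y in `]0%R, +oo[%classic)
  (Num.max ((y : R) `^ (al - dl)) ((y : R) `^ (al + dl)))%:E < +oo)%E.
Local Notation tl x := (`]x%R, +oo[%classic : set (measurableTypeR R)).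

Let W : R := \int[rho]_y weight al y.
Let iw := integrable_weight dl_gt0 moment.
Let iw2 := integrable_weight_moment dl_gt0 moment.
Let W_gt0 : 0 < W := weight_mass_gt0 al_gt0 dl_gt0 rho_pos rho_neq0 moment.

Variables (th a : R).
Hypothesis th_gt0 : 0 < th.
Hypothesis a_gt0 : 0 < a.
Hypothesis a_small : a * (al + th) <= al.
Hypothesis wcos_th : cos_transform rho (weight al) (@ln R) th = 0.
Hypothesis wsin_th : sin_transform rho (weight al) (@ln R) th = 0.

Let nu : {sigma_finite_measure set (measurableTypeR R) -> \bar R} :=
  oscM al_gt0 th_gt0 a_gt0 a_small.

Let nu_tail X : 0 < X -> nu (tl X) = (osc_tail al th a (ln X))%:E.
Proof. exact: osc_measure_tail. Qed.

Let wint_osc X : 0 < X ->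
  \int[rho]_y (weight al y * (X `^ (- al) * (1 + a * cos (th * (ln X - ln y))))) =
  X `^ (- al) * W.
Proof.
move=> X0.
have bc (g : R -> R) : measurable_fun setT g -> (forall v, `|g v| <= 1) ->
    rho.-integrable setT (EFin \o (fun y => weight al y * g (ln y))).
  move=> mg g1.
  exact: (integrable_weighted_int (@weight_ge0 R al) (@measurable_weight R al) (@measurable_ln R) iw2 mg g1).
have ic := bc _ (@measurable_cos_scale R th) (fun v => cos_max (th * v)).
have is_ := bc _ (@measurable_sin_scale R th) (fun v => sin_max (th * v)).
have iZ (c : R) g : rho.-integrable setT (EFin \o g) ->
    rho.-integrable setT (EFin \o (fun y => c * g y)).
  move=> ig; have := @integrableZl _ _ _ rho setT measurableT c _ ig.
  by apply: eq_integrable => // y _.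
pose p := X `^ (- al).
pose c1 := p * a * cos (th * ln X); pose c2 := p * a * sin (th * ln X).
rewrite (@eq_Rintegral _ _ _ rho setT (fun y => p * weight al y +
   (c1 * (weight al y * cos (th * ln y)) + c2 * (weight al y * sin (th * ln y))))); last first.
  by move=> y _; rewrite mulrBr cosB /c1 /c2 -/p; ring.
have i2 : rho.-integrable setT (EFin \o (fun y =>
   c1 * (weight al y * cos (th * ln y)) + c2 * (weight al y * sin (th * ln y)))).
  have := @integrableD _ _ _ rho setT measurableT _ _ (iZ c1 _ ic) (iZ c2 _ is_).
  by apply: eq_integrable => // y _.
rewrite RintegralD ?RintegralZl//; last exact: iZ.
rewrite RintegralD ?RintegralZl//; [|exact: iZ|exact: iZ].
rewrite -[\int[rho]_y (weight al y * cos (th * ln y))]/(cos_transform rho (weight al) (@ln R) th).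
rewrite -[\int[rho]_y (weight al y * sin (th * ln y))]/(sin_transform rho (weight al) (@ln R) th).
by rewrite wcos_th wsin_th !mulr0 !addr0.
Qed.

(** The oscillating part integrates to a combination of the two transforms of
    the weight at frequency [th], both zero. *)
Lemma mconv_osc X : 0 < X -> mconv nu rho (tl X) = (X `^ (- al) * W)%:E.
Proof.
move=> X0; rewrite mconv_tail -wint_osc// integral_mkcond /Rintegral fineK; last first.
  apply: integrable_fin_num => //.
  have mf : measurable_fun setT (fun v : R => X `^ (- al) * (1 + a * cos (th * (ln X - v)))).
    apply: measurable_funM => //; apply: measurable_funD => //.
    apply: measurable_funM => //.
    apply: (measurableT_comp (@measurable_cos_scale R th)).
    exact: measurable_funB.
  apply: (@integrable_weighted_int _ _ _ rho (weight al) (@ln R) (@weight_ge0 R al)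
     (@measurable_weight R al) (@measurable_ln R) iw2 _ (X `^ (- al) * 2) mf).
  move=> v; rewrite normrM (ger0_norm (powR_ge0 _ _)) ler_wpM2l ?powR_ge0//.
  have f0 := osc_factor_gt0 al_gt0 th_gt0 a_gt0 a_small (ln X - v).
  rewrite ger0_norm; last exact: ltW.
  have a1 : a < 1 by have := a_small; have := al_gt0; have := th_gt0; have := a_gt0; nra.
  by have := cos_le1 (th * (ln X - v)); have := a_gt0; nra.
apply: eq_integral => y _; rewrite patchE; case: ifPn => [/set_mem|y0] /=.
  rewrite in_itv/= andbT => y0; rewrite nu_tail ?divr_gt0//; congr EFin.
  rewrite weightE// powR_expR// /osc_tail lnM ?posrE ?invr_gt0// lnV ?posrE//.
  by rewrite mulrA -expRD; congr (expR _ * _); ring.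
rewrite weight0 ?mul0r// leNgt; apply/negP => y1; move/negP: y0; apply.
by apply/mem_set; rewrite /= in_itv/= y1.
Qed.

Lemma mconv_osc_rv : rv_tail_exp al (mconv nu rho).
Proof.
have W0 := W_gt0.
have rt X : 0 < X -> rtail (mconv nu rho) X = X `^ (- al) * W.
  by move=> X0; rewrite /rtail mconv_osc.
apply/rv_tail_expP; split; first exact: ltW.
- near=> X.
  have X0 : 0 < X by near: X; exact: near_pinfty_gt0.
  by rewrite mconv_osc// rt// mulr_gt0// powR_gt0.
- move=> c c0; apply: cvg_near_cst; near=> X.
  have X0 : 0 < X by near: X; exact: near_pinfty_gt0.
  rewrite !rt ?mulr_gt0// powRM ?ltW//; field.
  by rewrite !gt_eqF ?powR_gt0.
Unshelve. all: by end_near. Qed.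

(** Only [y > X / b] contributes; there [y `^ al] is at most
    [(X / b) `^ (- dl) * y `^ (al + dl)]. *)
Lemma osc_small_part (b X : R) : 0 < b -> 0 < X ->
  (small_part nu rho b X <= (2 * X `^ (- al) * (X / b) `^ (- dl))%:E *
   \int[rho]_(y in tl 0) (Num.max ((y : R) `^ (al - dl)) ((y : R) `^ (al + dl)))%:E)%E.
Proof.
move=> b0 X0; rewrite small_partE//.
have mi (i : interval R) : measurable ([set` i] : set (measurableTypeR R)).
  exact: measurable_itv.
have mm : measurable_fun (tl 0) (fun y : measurableTypeR R =>
   (Num.max ((y : R) `^ (al - dl)) ((y : R) `^ (al + dl)))%:E).
  apply/measurable_EFinP.
  by apply: measurable_maxr; apply: measurable_funTS; exact: measurable_powR.
have C0 : 0 <= 2 * X `^ (- al) * (X / b) `^ (- dl) by rewrite !mulr_ge0 ?powR_ge0.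
rewrite -ge0_integralZl//; last by move=> y _; rewrite lee_fin le_max powR_ge0.
apply: ge0_le_integral => //.
- exact: measurable_conv_section.
- exact: measurable_funeM.
move=> y /=; rewrite in_itv/= andbT => y0.
have [yb|yb] := lerP y (X / b).
  rewrite (_ : _ `&` _ = set0).
    by rewrite measure0 mule_ge0// lee_fin// le_max powR_ge0.
  apply/seteqP; split => z //=; rewrite !in_itv/= andbT => -[h /andP[_ zb]].
  have := lt_le_trans h zb; rewrite ltr_pdivrMr// => h2.
  by move: yb; rewrite ler_pdivlMr// mulrC leNgt h2.
apply: (@le_trans _ _ (nu (tl (X / y)))).
  by apply: le_measure; rewrite ?inE//; exact: measurableI.
rewrite nu_tail ?divr_gt0// -EFinM lee_fin.
apply: (le_trans (osc_le al_gt0 th_gt0 a_gt0 a_small _)).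
rewrite -!mulrA ler_wpM2l//.
have Xb : 0 < X / b by rewrite divr_gt0.
apply: (@le_trans _ _ (X `^ (- al) * ((X / b) `^ (- dl) * y `^ (al + dl)))); last first.
  by rewrite !ler_wpM2l ?powR_ge0// le_max lexx orbT.
rewrite !powR_expR// -!expRD ler_expR lnM ?posrE ?invr_gt0// lnV ?posrE//.
have : ln (X / b) <= ln y by rewrite ler_ln ?posrE// ltW.
have := dl_gt0; nra.
Qed.

Lemma osc_negligible : small_factor_negligible nu rho.
Proof.
have W0 := W_gt0.
apply: cvg_near_cst; near=> b.
have b0 : 0 < b by near: b; exact: nbhs_right_gt.
apply/eqP; rewrite eq_le; apply/andP; split; last first.
  apply: limf_esup_ge0; first exact: filter_not_empty.
  move=> X; apply: mule_ge0; first exact: integral_ge0.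
  by rewrite inve_ge0; exact: integral_ge0.
apply/lee_addgt0Pr => e e0; rewrite add0e.
set K := (\int[rho]_(y in tl 0) (Num.max ((y : R) `^ (al - dl)) ((y : R) `^ (al + dl)))%:E)%E.
have K0 : (0 <= K)%E by apply: integral_ge0 => y _; rewrite lee_fin le_max powR_ge0.
have Kfin : K \is a fin_num by rewrite ge0_fin_numE.
have k0 : 0 <= fine K by exact: fine_ge0.
have near_le : \forall X \near +oo,
    (small_part nu rho b X / mconv nu rho (tl X) <= e%:E)%E.
  pose D := 2 * fine K / (e * W) + 1.
  have D0 : 0 < D by rewrite ltr_wpDl// divr_ge0 ?mulr_ge0// ltW.
  near=> X.
  have X0 : 0 < X by near: X; exact: near_pinfty_gt0.
  have Xb : 0 < X / b by rewrite divr_gt0.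
  have XD : D <= (X / b) `^ dl.
    rewrite powR_expR//; have : ln D / dl <= ln (X / b).
      rewrite (mulrC X); near: X.
      apply: (near_pinfty_scale (P := fun x => ln D / dl <= ln x)); first by rewrite invr_gt0.
      apply: (near_ln (P := fun x => ln D / dl <= x)); apply: nbhs_pinfty_ge; exact: num_real.
    rewrite ler_pdivrMr// mulrC => h.
    by rewrite -{1}(lnK (_ : D \is Num.pos)) ?posrE// ler_expR.
  have Xal : 0 < X `^ (- al) by exact: powR_gt0.
  have t0 : 0 < X `^ (- al) * W by rewrite mulr_gt0.
  have sm := osc_small_part b0 X0; rewrite -/K -(fineK Kfin) -EFinM in sm.
  rewrite mconv_osc// inver gt_eqF//.
  have ti : (0 <= ((X `^ (- al) * W)^-1)%:E)%E by rewrite lee_fin invr_ge0 ltW.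
  apply: (le_trans (lee_wpmul2r ti sm)).
  rewrite -EFinM lee_fin ler_pdivrMr// (powRN (X / b)).
  have Xbd : 0 < (X / b) `^ dl by exact: powR_gt0.
  rewrite (_ : 2 * X `^ (- al) / (X / b) `^ dl * fine K =
     X `^ (- al) * (2 * fine K / (X / b) `^ dl)); last by ring.
  rewrite [leRHS]mulrCA ler_wpM2l ?(ltW Xal)// ler_pdivrMr//.
  have : e * W * D <= e * W * (X / b) `^ dl by rewrite ler_wpM2l// mulr_ge0// ltW.
  apply: le_trans; rewrite /D mulrDr mulr1.
  rewrite (_ : e * W * (2 * fine K / (e * W)) = 2 * fine K).
    by rewrite lerDl mulr_ge0// ltW.
  by field; rewrite !gt_eqF.
apply: (@le_trans _ _ (ereal_sup ((fun X : R => (small_part nu rho b X / mconv nu rho (tl X))%E)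
    @` [set X : R | (small_part nu rho b X / mconv nu rho (tl X) <= e%:E)%E]))).
  apply: ereal_inf_lbound; eexists; last reflexivity.
  exact: near_le.
by apply: ge_ereal_sup => _ [X /= h <-].
Unshelve. all: by end_near. Qed.

End Converse.

(** The frequency can be taken positive: the transforms are even and odd, and at
    frequency 0 the cosine transform is the total mass. *)
Lemma vanishing_frequency (R : realType) (al : R)
    (rho : {sigma_finite_measure set (measurableTypeR R) -> \bar R}) :
  rho.-integrable setT (EFin \o (fun y => weight al y * (1 + ln y ^+ 2))) ->
  0 < \int[rho]_y weight al y ->
  ~ (forall theta : R, cintegral rho `]0%R, +oo[%classic
       (fun y => cpow y (Complex al theta)) != 0) ->
  exists th : R, [/\ 0 < th, cos_transform rho (weight al) (@ln R) th = 0 &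
    sin_transform rho (weight al) (@ln R) th = 0].
Proof.
move=> iw2 W0 /nonvanishing_transform/existsNP[x /negP]; rewrite negbK.
rewrite paddr_eq0 ?sqr_ge0// !sqrf_eq0 => /andP[/eqP c0 /eqP s0].
have c_even : cos_transform rho (weight al) (@ln R) (- x) = 0.
  by rewrite -c0; apply: eq_Rintegral => y _; rewrite mulNr cosN.
have s_odd : sin_transform rho (weight al) (@ln R) (- x) = 0.
  rewrite -(mulr0 (-1)) -s0 /sin_transform /weighted_int -RintegralZl//.
    by apply: eq_Rintegral => y _; rewrite mulNr sinN mulrN mulN1r.
  exact: (integrable_weighted_int (@weight_ge0 R al) (@measurable_weight R al)
    (@measurable_ln R) iw2 (@measurable_sin_scale R x) (fun v => sin_max (x * v))).
have [x0|x0|x0] := ltgtP x 0.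
- by exists (- x); rewrite oppr_gt0.
- by exists x.
- move: c0; rewrite x0 /cos_transform /weighted_int; under eq_Rintegral do rewrite mul0r cos0 mulr1.
  by move=> W00; rewrite W00 ltxx in W0.
Qed.

Theorem theorem2p3 (R : realType) (alpha : R)
  (rho : {sigma_finite_measure set (measurableTypeR R) -> \bar R})
  (alpha_gt0 : 0 < alpha)
  (rho_pos : on_positives rho)
  (rho_neq0 : rho setT != 0%E)
  (rho_moment : exists2 delta : R, 0 < delta &
     (\int[rho]_(y in `]0%R, +oo[%classic)
        (Num.max ((y : R) `^ (alpha - delta)) ((y : R) `^ (alpha + delta)))%:E
      < +oo)%E) :
  ((forall theta : R,
      cintegral rho `]0, +oo[%classic (fun y => cpow y (Complex alpha theta)) != 0) ->
   forall nu : {sigma_finite_measure set (measurableTypeR R) -> \bar R},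
     on_positives nu ->
     rv_tail_exp alpha (mconv nu rho) ->
     small_factor_negligible nu rho ->
     rv_tail_exp alpha nu /\
     (mconv nu rho `]x, +oo[%classic / nu `]x, +oo[%classic)%E @[x --> +oo%R]
       --> (\int[rho]_(y in `]0%R, +oo[%classic) ((y : R) `^ alpha)%:E)%E) /\
  (~ (forall theta : R,
      cintegral rho `]0, +oo[%classic (fun y => cpow y (Complex alpha theta)) != 0) ->
   exists nu : {sigma_finite_measure set (measurableTypeR R) -> \bar R},
     [/\ on_positives nu,
         ~ rv_tail nu,
         rv_tail_exp alpha (mconv nu rho) &
         small_factor_negligible nu rho]).
Proof.
have [dl dl0 moment] := rho_moment; split.
- move=> nv nu nu_pos rv small; split.
    exact: factor_rv_tail alpha_gt0 dl0 rho_pos rho_neq0 moment rv small nv.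
  exact: mconv_tail_ratio alpha_gt0 dl0 rho_pos rho_neq0 moment rv small nv.
- move=> v; have W0 := weight_mass_gt0 alpha_gt0 dl0 rho_pos rho_neq0 moment.
  have iw2 := integrable_weight_moment dl0 moment.
  have [th [th0 c0 s0]] := vanishing_frequency iw2 W0 v.
  pose a := alpha / (alpha + th).
  have a0 : 0 < a by rewrite divr_gt0// addr_gt0.
  have a_small : a * (alpha + th) <= alpha by rewrite divfK// gt_eqF// addr_gt0.
  exists (oscM alpha_gt0 th0 a0 a_small); split.
  + exact: osc_measure_neg.
  + exact: osc_not_rv.
  + exact: (mconv_osc_rv alpha_gt0 dl0 rho_pos rho_neq0 moment th0 a0 a_small c0 s0).
  + exact: (osc_negligible alpha_gt0 dl0 rho_pos rho_neq0 moment th0 a0 a_small c0 s0).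
Qed.
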